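(* Let $\alpha\le 2$ be a real number and let $n\ge 5$ be an integer. Among all convex $n$-gons $\Gamma_n$ (possibly degenerate) in the plane with each edge of length $1$, $E_n^\alpha(\Gamma_n)$ reaches its maximum if and only if $\Gamma_n$ is (congruent to) $\Gamma_n^o$, the regular $n$-gon of edge length $1$.
   Context: For $\alpha\in\mathbb{R}$ define $f_\alpha:(0,\infty)\to\mathbb{R}$ by $f_\alpha(x)=x^\alpha$ if $\alpha>0$, $f_\alpha(x)=\ln x$ if $\alpha=0$, and $f_\alpha(x)=-x^\alpha$ if $\alpha<0$. The value $f_\alpha(0)$ is understood as $\lim_{x\to0^+}f_\alpha(x)$, which is $0$ if $\alpha>0$ and $-\infty$ if $\alpha\le 0$. For a polygon $\Gamma_n$ with vertices $A_1,\dots,A_n$, $E^\alpha_n(\Gamma_n)=\sum_{1\le p<q\le n} f_\alpha(|A_pA_q|)\in[-\infty,\infty)$, where $|A_pA_q|$ is the Euclidean distance. A convex $n$-gon (possibly degenerate) with each edge of length $1$ is a closed polygon in a plane with vertices $A_1,\dots,A_n$ (cyclic indices, $A_{n+1}=A_1$) with $|A_iA_{i+1}|=1$ for all $i$, such that, with $C$ the convex hull of the vertices, $A_1,\dots,A_n$ lie on the boundary closed curve $\partial C$ and occur on it in this cyclic order during a single traversal. Angles equal to $\pi$ are allowed. If all $A_i$ are collinear (degenerate case), $C$ is a segment and $\partial C$ is understood as that segment traversed once forth and once back. *)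

(* Defs.v *)
From HB Require Import structures.
From mathcomp Require Import all_boot all_order all_algebra.
From mathcomp Require Import all_classical all_reals all_analysis.

Set Implicit Arguments.
Unset Strict Implicit.
Unset Printing Implicit Defensive.

Import Order.TTheory GRing.Theory Num.Theory.
Import numFieldNormedType.Exports.

Local Open Scope classical_set_scope.
Local Open Scope ring_scope.

(* The norm of 'rV[R]_2 in the library is the max norm, hence this Euclidean
   distance; both induce the same topology. *)
Definition eucl_dist (R : realType) (x y : 'rV[R]_2) : R :=
  Num.sqrt (\sum_(k < 2) (x 0 k - y 0 k) ^+ 2).

(* f_alpha on [0, +oo), with f_alpha 0 the limit at 0+; in the first branch
   0 `^ alpha = 0. *)
Definition falpha (R : realType) (alpha x : R) : \bar R :=
  if 0 < alpha then (x `^ alpha)%:E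
  else if x == 0 then -oo%E
  else if alpha == 0 then (ln x)%:E
  else (- (x `^ alpha))%:E.

(* A polygon is its cyclic sequence of vertices, indexed from 0; the successor
   index is [ordS]. *)
Definition energy (R : realType) (n : nat) (alpha : R) (A : 'I_n -> 'rV[R]_2)
    : \bar R :=
  (\sum_(p < n) \sum_(q < n | (p < q)%N) falpha alpha (eucl_dist (A p) (A q)))%E.

Definition unit_edges (R : realType) (n : nat) (A : 'I_n -> 'rV[R]_2) : Prop :=
  forall i : 'I_n, eucl_dist (A i) (A (ordS i)) = 1.

Definition convex_hull (R : realType) (X : set 'rV[R]_2) : set 'rV[R]_2 :=
  smallest (@convex_set R 'rV[R]_2) X.

Definition boundary (T : topologicalType) (C : set T) : set T :=
  closure C `\` interior C.

Definition collinear (R : realType) (n : nat) (A : 'I_n -> 'rV[R]_2) : Prop :=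
  exists P v : 'rV[R]_2, forall i : 'I_n, exists s : R, A i = P + s *: v.

(* Closed curves are 1-periodic maps on R; one traversal is any window of
   length 1. *)
Definition traverses_simply (R : realType) (g : R -> 'rV[R]_2)
    (D : set 'rV[R]_2) : Prop :=
  [/\ continuous g, periodic g 1,
      set_inj `[0, 1[ g & range g = D].

Definition traverses_forth_and_back (R : realType) (g : R -> 'rV[R]_2)
    (D : set 'rV[R]_2) : Prop :=
  periodic g 1 /\
  exists P Q : 'rV[R]_2,
    [/\ D = [set (1 - s) *: P + s *: Q | s in `[0, 1]],
        forall s : R, 0 <= s <= 1 -> g (s / 2) = (1 - s) *: P + s *: Q
      & forall s : R, 0 <= s <= 1 -> g ((1 + s) / 2) = (1 - s) *: Q + s *: P].

Definition boundary_traversal (R : realType) (n : nat) (A : 'I_n -> 'rV[R]_2)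
    (g : R -> 'rV[R]_2) : Prop :=
  (~ collinear A /\
     traverses_simply g (boundary (convex_hull (range A)))) \/
  (collinear A /\
     traverses_forth_and_back g (convex_hull (range A))).

(* All parameters t i lie in one period, in increasing order.  In the
   degenerate case a point may carry two vertices, met on the way forth and on
   the way back. *)
Definition convex_polygon (R : realType) (n : nat) (A : 'I_n -> 'rV[R]_2)
    : Prop :=
  exists g : R -> 'rV[R]_2, boundary_traversal A g /\
  exists t : 'I_n -> R,
    [/\ forall i j : 'I_n, (i < j)%N -> t i < t j,
        forall i j : 'I_n, t j < t i + 1
      & forall i : 'I_n, A i = g (t i)].

Definition convex_unit_polygon (R : realType) (n : nat)
    (A : 'I_n -> 'rV[R]_2) : Prop :=
  convex_polygon A /\ unit_edges A.

Definition congruent (R : realType) (n : nat) (A B : 'I_n -> 'rV[R]_2)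
    : Prop :=
  exists f : 'rV[R]_2 -> 'rV[R]_2,
    (forall x y, eucl_dist (f x) (f y) = eucl_dist x y) /\
    (forall i : 'I_n, A i = f (B i)).

(* A regular n-gon with edge length 1 has circumradius 1 / (2 sin (pi / n)). *)
Definition regular_ngon (R : realType) (n : nat) (i : 'I_n) : 'rV[R]_2 :=
  let r : R := (2 * sin (pi / n%:R))^-1 in
  let theta : R := 2 * pi * i%:R / n%:R in
  \row_(k < 2) (if k == 0 then r * cos theta else r * sin theta).

(* Main.v *)
Require Import Defs.
From mathcomp Require Import all_boot all_order all_algebra.
From mathcomp Require Import all_classical all_reals all_analysis.
From mathcomp Require Import ring lra zify.

Set Implicit Arguments.
Unset Strict Implicit.
Unset Printing Implicit Defensive.

Import Order.TTheory GRing.Theory Num.Theory.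
Import numFieldNormedType.Exports.

Local Open Scope classical_set_scope.
Local Open Scope ring_scope.

(* Write f_alpha(sqrt u) = g(u): for alpha <= 2 the function g is increasing and
   concave, so g lies below its tangent at each squared chord length v_k of the
   regular n-gon, and it suffices to show, for every k, that
     sum_j |A_{j+k} A_j|^2 <= n v_k,  v_k = (sin (k pi/n) / sin (pi/n))^2.
   By Parseval the left side is (4/n) sum_m P_m sin^2(k m pi/n), where P_m is the
   energy of the m-th harmonic of the closed polygon; for k = 1 it equals n, and
   |sin (k m pi/n)| / sin (m pi/n) <= sin (k pi/n) / sin (pi/n) finishes the
   bound.  Equality for k = 2 leaves only the harmonics 0, 1 and n-1, so the
   polygon is an affine image of the regular one, and the unit edges force the
   linear part to be a similarity once n >= 5 (for n = 4 rhombi survive).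
   The regular n-gon is itself convex: the hull of its vertices is cut out by the
   n half-planes of its edges, and dividing (cos, sin) by the gauge of this region
   parametrizes the boundary. *)

(** * The ratio of sines *)

Lemma sin_natSr (R : realType) (k : nat) (t : R) :
  sin (k.+1%:R * t) = sin (k%:R * t) * cos t + cos (k%:R * t) * sin t.
Proof. by rewrite -natr1 mulrDl mul1r sinD. Qed.

Lemma ler_cos_0pi (R : realType) (a b : R) :
  0 <= a -> a <= b -> b <= pi -> cos b <= cos a.
Proof.
move=> a0 ab bpi; rewrite le_eqVlt in ab; case/predU1P: ab => [->//|ab].
by apply/ltW; rewrite ltr_cos// in_itv/=; apply/andP; split=> //; lra.
Qed.

Lemma ler_sin_0pihalf (R : realType) (a b : R) :
  0 <= a -> a <= b -> b <= pi / 2 -> sin a <= sin b.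
Proof.
move=> a0 ab bpi; rewrite -!(cosBpihalf _) -cosN -[leRHS]cosN.
by have := pi_gt0 R => ?; apply: ler_cos_0pi; lra.
Qed.

(** The ratio satisfies [sin ((k+1) x) / sin x = (sin (k x) / sin x) cos x + cos (k x)], and both
    summands decrease in [x]; hence the induction on [k]. The bound [k b <= pi], one below the
    multiplier [k + 1], is what makes [cos (k x)] decrease. *)
Lemma sin_ratio_decreasing (R : realType) (k : nat) (a b : R) :
  0 < a -> a <= b -> b <= pi / 2 -> k%:R * b <= pi ->
  sin (k.+1%:R * b) * sin a <= sin (k.+1%:R * a) * sin b.
Proof.
move=> a0 ab bpi; have b0 : 0 < b by exact: lt_le_trans ab.
have pi0 := pi_gt0 R.
elim: k => [_|k IH kb]; first by rewrite !mul1r mulrC.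
have kb' : k%:R * b <= pi by move: kb; rewrite -natr1; lra.
have {IH} := IH kb'.
rewrite (sin_natSr k.+1 b) (sin_natSr k.+1 a).
have ka : 0 <= k.+1%:R * a by rewrite mulr_ge0// ltW.
have kakb : k.+1%:R * a <= k.+1%:R * b by rewrite ler_wpM2l.
have cosk := ler_cos_0pi ka kakb kb.
have sink : 0 <= sin (k.+1%:R * a) by apply: sin_ge0_pi; lra.
have cosb : cos b <= cos a by apply: ler_cos_0pi; lra.
have cosb0 : 0 <= cos b by apply: cos_ge0_pihalf; lra.
have sinb : 0 <= sin b by apply: sin_ge0_pi; lra.
have sina : 0 <= sin a by apply: sin_ge0_pi; lra.
move: cosk cosb sink; move: (sin (_ * a)) (sin (_ * b)) (cos (_ * a)) (cos (_ * b)).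
move=> sk sk' ck ck' ckk cab sk0 IH.
apply: (@le_trans _ _ (sk * sin b * cos b + ck * sin b * sin a)).
  rewrite !mulrDl lerD//.
    by rewrite -mulrA [cos b * _]mulrC mulrA ler_wpM2r.
  by do 2 rewrite ler_wpM2r//.
rewrite mulrDl -!mulrA [sin a * sin b]mulrC lerD2r ler_wpM2l//.
by rewrite mulrC ler_wpM2r.
Qed.

(* Beyond [k b = pi] the trivial bound [|sin (k b)| <= 1] suffices, because the
   ratio at [pi / (2 k)] equals [1 / sin (pi / (2 k))]. *)
Lemma norm_sin_ratio_le (R : realType) (k : nat) (a b : R) :
  (0 < k)%N -> 0 < a -> a <= b -> b <= pi / 2 -> k%:R * a <= pi / 2 ->
  `|sin (k%:R * b)| * sin a <= sin (k%:R * a) * sin b.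
Proof.
case: k => // k _ a0 ab bpi kapi.
have pi0 := pi_gt0 R; have k1 : 1 <= k.+1%:R :> R by rewrite ler1n.
have [kb|kb] := leP (k.+1%:R * b) pi.
  rewrite ger0_norm; last by apply: sin_ge0_pi; rewrite kb mulr_ge0//; lra.
  apply: sin_ratio_decreasing => //; apply: le_trans kb.
  by rewrite ler_wpM2r ?ler_nat//; lra.
pose c : R := pi / 2 / k.+1%:R.
have kc : k.+1%:R * c = pi / 2 by rewrite /c mulrCA divff ?mulr1 ?pnatr_eq0.
have ac : a <= c by rewrite -(@ler_pM2l _ k.+1%:R) ?ltr0n// kc.
have cb : c <= b by rewrite -(@ler_pM2l _ k.+1%:R) ?ltr0n// kc; lra.
have := @sin_ratio_decreasing R k a c a0 ac (le_trans cb bpi).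
rewrite kc sin_pihalf mul1r => H.
apply: (@le_trans _ _ (sin a)).
  by rewrite ler_piMl ?sin_max//; apply: sin_ge0_pi; lra.
apply: le_trans (H _) _.
  by move: kc; rewrite -natr1 mulrDl mul1r => ?; lra.
rewrite ler_wpM2l//; last by apply: ler_sin_0pihalf => //; lra.
by apply: sin_ge0_pi; rewrite mulr_ge0//; lra.
Qed.

Lemma sin2_addpi (R : realType) (k : nat) (x : R) :
  sin (x + k%:R * pi) ^+ 2 = sin x ^+ 2.
Proof. by rewrite mulr_natl (alternatingn (@sinDpi R)) exprMn sqrr_sign mul1r. Qed.

Lemma sin2_subpi (R : realType) (k : nat) (x : R) :
  sin (k%:R * pi - x) ^+ 2 = sin x ^+ 2.
Proof. by rewrite addrC sin2_addpi sinN sqrrN. Qed.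

Lemma sin_pidiv_gt0 (R : realType) (n k : nat) :
  (0 < k)%N -> (k < n)%N -> 0 < sin (k%:R * (pi / n%:R)) :> R.
Proof.
move=> k0 kn; have pi0 := pi_gt0 R; have n0 : (0 < n)%N by exact: leq_ltn_trans kn.
apply: sin_gt0_pi; rewrite mulr_gt0 ?divr_gt0 ?ltr0n//=.
by rewrite mulrCA gtr_pMr// ltr_pdivrMr ?ltr0n// mul1r ltr_nat.
Qed.

(** The squares are invariant under [m -> n - m] and [k -> n - k], so both indices may be taken at
    most [n / 2], where [norm_sin_ratio_le] applies to the angles [pi / n] and [m pi / n]. *)
Lemma sin2_ratio_le (R : realType) (n m k : nat) :
  (m <= n)%N -> (0 < k)%N -> (k < n)%N ->
  sin (k%:R * (m%:R * (pi / n%:R))) ^+ 2 * sin (pi / n%:R) ^+ 2 <=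
  sin (k%:R * (pi / n%:R)) ^+ 2 * sin (m%:R * (pi / n%:R)) ^+ 2 :> R.
Proof.
have pi0 := pi_gt0 R.
move=> mn k0 kn; have n0 : (0 < n)%N by exact: leq_ltn_trans kn.
have nR : n%:R != 0 :> R by rewrite pnatr_eq0 -lt0n.
wlog m2 : m mn / (m.*2 <= n)%N => [wl|].
  have [|nm] := leqP m.*2 n; first exact: wl.
  have := @wl (n - m)%N (leq_subr _ _).
  rewrite natrB//.
  have -> : (n%:R - m%:R) * (pi / n%:R) = 1%:R * pi - m%:R * (pi / n%:R) :> R.
    by field.
  rewrite sin2_subpi mulrBr mul1r sin2_subpi; apply.
  by rewrite doubleB leq_subLR -addnn leq_add2r ltnW.
wlog k2 : k k0 kn / (k.*2 <= n)%N => [wl|].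
  have [|nk] := leqP k.*2 n; first exact: wl.
  have := @wl (n - k)%N; rewrite subn_gt0 ltn_subrL k0 n0 natrB ?(ltnW kn)//.
  have -> : (n%:R - k%:R) * (m%:R * (pi / n%:R)) =
            m%:R * pi - k%:R * (m%:R * (pi / n%:R)) :> R by field.
  have -> : (n%:R - k%:R) * (pi / n%:R) = 1%:R * pi - k%:R * (pi / n%:R) :> R.
    by field.
  rewrite !sin2_subpi; apply => //.
  by rewrite doubleB leq_subLR -addnn leq_add2r ltnW.
have [->|m0] := posnP m.
  by rewrite !mul0r mulr0 sin0 expr0n/= !(mul0r, mulr0).
have half (i : nat) : (i.*2 <= n)%N -> i%:R * (pi / n%:R) <= pi / 2 :> R.
  move=> i2; rewrite mulrCA ler_pM2l// ler_pdivrMr ?ltr0n//.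
  by rewrite mulrC ler_pdivlMr// -natrM muln2 ler_nat.
have a0 : 0 < pi / n%:R :> R by rewrite divr_gt0 ?ltr0n.
have := @norm_sin_ratio_le R k (pi / n%:R) (m%:R * (pi / n%:R)) k0 a0 _ (half _ m2) (half _ k2).
rewrite ler_peMl ?ler1n//; last exact: ltW.
move=> /(_ erefl) H.
rewrite -!exprMn -[leLHS]real_normK ?num_real// normrM.
have sa : 0 < sin (pi / n%:R) :> R.
  by rewrite -[pi / _]mul1r (@sin_pidiv_gt0 _ n 1)//; exact: leq_ltn_trans kn.
rewrite [X in _ * X]ger0_norm ?(ltW sa)//.
rewrite ler_sqr// nnegrE.
  by rewrite mulr_ge0// ltW.
by rewrite mulr_ge0// ltW// sin_pidiv_gt0// (leq_trans _ m2)// -addnn -[ltnLHS]addn0 ltn_add2l.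
Qed.

(** * Discrete Fourier analysis *)

Lemma cosD2piMn (R : realType) (k : nat) (x : R) : cos (x + k%:R * (2 * pi)) = cos x.
Proof. by rewrite !mulr_natl (periodicn (@cosD2pi R)). Qed.

Lemma sinD2piMn (R : realType) (k : nat) (x : R) : sin (x + k%:R * (2 * pi)) = sin x.
Proof. by rewrite !mulr_natl (periodicn (@sinD2pi R)). Qed.

(** Multiplied by [2 sin h], with [h] half the step, the sum telescopes; its two end terms differ by
    [d] full turns. The bounds on [d] keep [sin h] away from zero. *)
Lemma sum_cos_arith (R : realType) (n d : nat) (c : R) :
  (0 < d)%N -> (d < n)%N ->
  \sum_(m < n) cos (m%:R * (d%:R * (2 * pi / n%:R)) + c) = 0.
Proof.
move=> d0 dn; have n0 : (0 < n)%N by exact: leq_ltn_trans dn.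
have nR : n%:R != 0 :> R by rewrite pnatr_eq0 -lt0n.
pose h : R := d%:R * (pi / n%:R).
have h0 : sin h != 0 by rewrite gt_eqF// sin_pidiv_gt0.
have -> : d%:R * (2 * pi / n%:R) = 2 * h by rewrite /h; ring.
have tele (N : nat) : 2 * sin h * \sum_(m < N) cos (m%:R * (2 * h) + c) =
    sin (N%:R * (2 * h) + c - h) - sin (c - h).
  elim: N => [|N IH]; first by rewrite big_ord0 mul0r add0r mulr0 subrr.
  rewrite big_ord_recr/= mulrDr IH -[N.+1%:R]natr1.
  have -> : (N%:R + 1) * (2 * h) + c - h = (N%:R * (2 * h) + c) + h by ring.
  by move: (_ + c) => X; rewrite (sinB X) (sinD X); ring.
have : 2 * sin h != 0 by rewrite mulf_neq0.
move=> /mulfI; apply; rewrite tele mulr0.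
have -> : n%:R * (2 * h) + c - h = (c - h) + d%:R * (2 * pi).
  by rewrite /h; field.
by rewrite sinD2piMn subrr.
Qed.

Lemma sum_cos_orthogonal (R : realType) (n : nat) (j l : 'I_n) :
  \sum_(m < n) cos (m%:R * ((j%:R - l%:R) * (2 * pi / n%:R))) =
  n%:R *+ (j == l) :> R.
Proof.
have sym (x y : R) : cos (x * (y * (2 * pi / n%:R))) = cos (x * (- y * (2 * pi / n%:R))).
  by rewrite -cosN; congr cos; ring.
have [->|jl] := eqVneq j l.
  under eq_bigr do rewrite subrr mul0r mulr0 cos0.
  by rewrite sumr_const card_ord.
wlog lj : j l jl / (l < j)%N => [wl|].
  move: jl; rewrite -val_eqE neq_ltn => /orP[jl|jl]; last first.
    by apply: wl => //; rewrite -val_eqE neq_ltn jl orbT.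
  under eq_bigr do rewrite sym opprB.
  by apply: wl => //; rewrite -val_eqE neq_ltn jl orbT.
under eq_bigr do rewrite -natrB ?(ltnW lj)// -[_ * _]addr0.
rewrite sum_cos_arith ?mulr0n// ?subn_gt0//.
by rewrite (leq_ltn_trans (leq_subr _ _)).
Qed.

(** The unnormalized discrete Fourier coefficient of [x] at frequency [m] is
    [fourier_cos x m - i fourier_sin x m]; keeping the two real parts apart avoids complex numbers.
    [power_spectrum] is its squared modulus. *)
Definition fourier_cos (R : realType) (n : nat) (x : 'I_n -> R) (m : nat) : R :=
  \sum_(j < n) x j * cos (m%:R * (j%:R * (2 * pi / n%:R))).

Definition fourier_sin (R : realType) (n : nat) (x : 'I_n -> R) (m : nat) : R :=
  \sum_(j < n) x j * sin (m%:R * (j%:R * (2 * pi / n%:R))).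

Definition power_spectrum (R : realType) (n : nat) (x : 'I_n -> R) (m : nat) : R :=
  fourier_cos x m ^+ 2 + fourier_sin x m ^+ 2.

Lemma fourier_inversion (R : realType) (n : nat) (x : 'I_n -> R) (j : 'I_n) :
  \sum_(m < n) (fourier_cos x m * cos (m%:R * (j%:R * (2 * pi / n%:R)))
              + fourier_sin x m * sin (m%:R * (j%:R * (2 * pi / n%:R)))) =
  n%:R * x j.
Proof.
transitivity (\sum_(m < n) \sum_(l < n)
    x l * cos (m%:R * ((j%:R - l%:R) * (2 * pi / n%:R)))).
  apply: eq_bigr => m _; rewrite !mulr_suml -big_split/=.
  apply: eq_bigr => l _; rewrite mulrBl mulrBr cosB; ring.
rewrite exchange_big/=.
under eq_bigr do rewrite -mulr_sumr sum_cos_orthogonal.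
rewrite (bigD1 j)//= eqxx big1 ?addr0 1?mulrC// => l lj.
by rewrite eq_sym (negbTE lj) mulr0n mulr0.
Qed.

Lemma parseval (R : realType) (n : nat) (x : 'I_n -> R) :
  \sum_(m < n) power_spectrum x m = n%:R * \sum_(j < n) x j ^+ 2.
Proof.
transitivity (\sum_(m < n) \sum_(j < n) x j *
    (fourier_cos x m * cos (m%:R * (j%:R * (2 * pi / n%:R)))
   + fourier_sin x m * sin (m%:R * (j%:R * (2 * pi / n%:R))))).
  apply: eq_bigr => m _; rewrite /power_spectrum !expr2.
  rewrite {1}/fourier_cos {1}/fourier_sin !mulr_suml -big_split/=.
  by apply: eq_bigr => j _; ring.
rewrite exchange_big/= mulr_sumr; apply: eq_bigr => j _.
by rewrite -mulr_sumr fourier_inversion; ring.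
Qed.

(** * Cyclic shifts and differences in the frequency domain *)

Section shift.
Variables (R : realType) (n : nat) (k : nat).
Let N := n.+1.
Implicit Types x : 'I_N -> R.

Lemma val_shift (j : 'I_N) : (j + inZp k : 'I_N)%R = ((j + k) %% N)%N :> nat.
Proof. by rewrite /= modnDmr. Qed.

(** Reducing the index modulo [N] changes the angle by a multiple of [2 pi] only. *)
Lemma cos_shift m (j : 'I_N) :
  cos (m%:R * ((nat_of_ord (j + inZp k : 'I_N)%R)%:R * (2 * pi / N%:R))) =
  cos (m%:R * ((j%:R + k%:R) * (2 * pi / N%:R))) :> R.
Proof.
rewrite val_shift -natrD [in RHS](divn_eq (j + k) N) natrD natrM.
rewrite -(cosD2piMn (m * ((j + k) %/ N))) natrM; congr cos.
have : N%:R != 0 :> R by rewrite pnatr_eq0.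
by move=> ?; field.
Qed.

Lemma sin_shift m (j : 'I_N) :
  sin (m%:R * ((nat_of_ord (j + inZp k : 'I_N)%R)%:R * (2 * pi / N%:R))) =
  sin (m%:R * ((j%:R + k%:R) * (2 * pi / N%:R))) :> R.
Proof.
rewrite val_shift -natrD [in RHS](divn_eq (j + k) N) natrD natrM.
rewrite -(sinD2piMn (m * ((j + k) %/ N))) natrM; congr sin.
have : N%:R != 0 :> R by rewrite pnatr_eq0.
by move=> ?; field.
Qed.

(** A shift by [k] multiplies the complex coefficient by [exp (i t)]; this is the real part, and
    [fourier_sin_shift] is the imaginary one. *)
Lemma fourier_cos_shift x m :
  let t := m%:R * (k%:R * (2 * pi / N%:R)) in
  fourier_cos (fun j => x (j + inZp k)%R) m =
  cos t * fourier_cos x m + sin t * fourier_sin x m.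
Proof.
move=> t; rewrite /fourier_cos /fourier_sin.
rewrite [in RHS](reindex_inj (addIr (inZp k : 'I_N))).
rewrite [X in _ + _ * X](reindex_inj (addIr (inZp k : 'I_N))).
rewrite !mulr_sumr -big_split/=; apply: eq_bigr => j _.
rewrite cos_shift sin_shift.
rewrite (_ : m%:R * ((_ + _) * _) = m%:R * (j%:R * (2 * pi / N%:R)) + t); last first.
  by rewrite /t; ring.
rewrite cosD sinD.
have := cos2Dsin2 t; set c := cos t; set s := sin t => cs1.
(* A factor [cos t ^ 2 + sin t ^ 2] on the left turns the goal into a polynomial identity. *)
by rewrite -[LHS]mulr1 -cs1; ring.
Qed.

Lemma fourier_sin_shift x m :
  let t := m%:R * (k%:R * (2 * pi / N%:R)) in
  fourier_sin (fun j => x (j + inZp k)%R) m =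
  cos t * fourier_sin x m - sin t * fourier_cos x m.
Proof.
move=> t; rewrite /fourier_cos /fourier_sin.
rewrite [X in _ * X - _](reindex_inj (addIr (inZp k : 'I_N))).
rewrite [X in _ - _ * X](reindex_inj (addIr (inZp k : 'I_N))).
rewrite !mulr_sumr -sumrB; apply: eq_bigr => j _.
rewrite cos_shift sin_shift.
rewrite (_ : m%:R * ((_ + _) * _) = m%:R * (j%:R * (2 * pi / N%:R)) + t); last first.
  by rewrite /t; ring.
rewrite cosD sinD.
have := cos2Dsin2 t; set c := cos t; set s := sin t => cs1.
by rewrite -[LHS]mulr1 -cs1; ring.
Qed.

(** The difference multiplies the coefficient by [exp (2 i h) - 1], whose squared modulus is
    [4 sin^2 h], with [h = k m pi / N]. *)
Lemma power_spectrum_diff x m :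
  power_spectrum (fun j => x (j + inZp k)%R - x j) m =
  4 * sin (k%:R * (m%:R * (pi / N%:R))) ^+ 2 * power_spectrum x m.
Proof.
have cB : fourier_cos (fun j => x (j + inZp k)%R - x j) m =
    fourier_cos (fun j => x (j + inZp k)%R) m - fourier_cos x m.
  by rewrite -sumrB; apply: eq_bigr => j _; rewrite mulrBl.
have sB : fourier_sin (fun j => x (j + inZp k)%R - x j) m =
    fourier_sin (fun j => x (j + inZp k)%R) m - fourier_sin x m.
  by rewrite -sumrB; apply: eq_bigr => j _; rewrite mulrBl.
rewrite /power_spectrum cB sB fourier_cos_shift fourier_sin_shift.
set h := k%:R * (m%:R * _).
have -> : m%:R * (k%:R * (2 * pi / N%:R)) = h *+ 2 by rewrite /h; ring.
rewrite cos_mulr2n sin_mulr2n; have := cos2Dsin2 h.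
set c := cos h; set s := sin h => cs1.
have c2 : c ^+ 2 = 1 - s ^+ 2 by rewrite -cs1; ring.
set u := fourier_cos x m; set v := fourier_sin x m.
rewrite c2; transitivity (4 * s ^+ 2 * (u ^+ 2 + v ^+ 2) * (s ^+ 2 + c ^+ 2)).
  by ring.
by rewrite c2; ring.
Qed.

Lemma sum_sqr_shift_diff x :
  N%:R * \sum_(j < N) (x (j + inZp k)%R - x j) ^+ 2 =
  4 * \sum_(m < N) sin (k%:R * (m%:R * (pi / N%:R))) ^+ 2 * power_spectrum x m.
Proof.
rewrite -(parseval (fun j => x (j + inZp k)%R - x j)) mulr_sumr.
by apply: eq_bigr => m _; rewrite power_spectrum_diff -mulrA.
Qed.

End shift.

(** * The tangent inequality and the chords of the regular polygon *)

Lemma ln_le_subr1 (R : realType) (x : R) : 0 < x -> ln x <= x - 1.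
Proof. by move=> x0; rewrite -{1}[x](addrNK 1) addrC le_ln1Dx//; lra. Qed.

(** With [t] the right-hand side, [w / t] and [1 / t] have mean 1 for the weights [b] and [1 - b].
    Averaging [ln x <= x - 1] at these two points gives [b ln w <= ln t]. *)
Lemma powR_bernoulli_le (R : realType) (b w : R) :
  0 < b -> b <= 1 -> 0 <= w -> w `^ b <= 1 + b * (w - 1).
Proof.
move=> b0 b1; rewrite le_eqVlt => /predU1P[<-|w0].
  by rewrite powR0 ?gt_eqF//; lra.
pose t : R := 1 + b * (w - 1).
have t0 : 0 < t.
  by have := mulr_gt0 b0 w0; rewrite /t; lra.
rewrite -ler_ln ?posrE ?powR_gt0// ln_powR -/t.
have t1 : 0 < t^-1 by rewrite invr_gt0.
have h1 : ln w - ln t <= w / t - 1 by rewrite -ln_div ?posrE// ln_le_subr1// divr_gt0.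
have h2 : - ln t <= t^-1 - 1 by rewrite -lnV ?posrE// ln_le_subr1.
have e : b * (w / t) + (1 - b) * t^-1 = 1.
  by apply: (mulIf (lt0r_neq0 t0)); rewrite mulrDl -!mulrA mulVf ?gt_eqF// /t; ring.
have h3 := ler_wpM2l (ltW b0) h1.
have b1' : 0 <= 1 - b by lra.
have h4 := ler_wpM2l b1' h2.
lra.
Qed.

Lemma powR_bernoulli_ge (R : realType) (b w : R) :
  b < 0 -> 0 < w -> 1 + b * (w - 1) <= w `^ b.
Proof.
move=> b0 w0; rewrite /powR gt_eqF//.
apply: le_trans (expR_ge1Dx _).
by rewrite lerD2l ler_wnM2l ?ln_le_subr1// ltW.
Qed.

Lemma sqrtr_powR (R : realType) (a u : R) : 0 <= u ->
  Num.sqrt u `^ a = u `^ (a / 2).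
Proof. by move=> u0; rewrite -powR12_sqrt// -powRrM mulrC. Qed.

(** The derivative at [v] of [u -> falpha alpha (sqrt u)]; the absolute value covers both signs of
    [alpha]. *)
Definition falpha_slope (R : realType) (alpha v : R) : R :=
  (if alpha == 0 then 2^-1 else `|alpha| / 2 * v `^ (alpha / 2)) / v.

Lemma falpha_slope_gt0 (R : realType) (alpha v : R) :
  0 < v -> 0 < falpha_slope alpha v.
Proof.
move=> v0; rewrite divr_gt0//; case: ifPn => a0; first by rewrite invr_gt0.
by rewrite mulr_gt0 ?powR_gt0// divr_gt0// normr_gt0.
Qed.

Lemma falpha_fin (R : realType) (alpha x : R) :
  0 < x -> falpha alpha x \is a fin_num.
Proof. by move=> x0; rewrite /falpha (gt_eqF x0); case: ifP => // _; case: ifP. Qed.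

(** Scaling by [v] moves the point of tangency to 1, where the claim is a Bernoulli inequality with
    exponent [alpha / 2], or [ln w <= w - 1] when [alpha = 0]. For positive [alpha] the bound
    [alpha <= 2] is the concavity condition [alpha / 2 <= 1]. *)
Lemma falpha_sqrt_le_tangent (R : realType) (alpha u v : R) :
  alpha <= 2 -> 0 <= u -> 0 < v ->
  (falpha alpha (Num.sqrt u) <=
   falpha alpha (Num.sqrt v) + (falpha_slope alpha v * (u - v))%:E)%E.
Proof.
move=> a2 u0 v0.
have vV : 0 < v^-1 by rewrite invr_gt0.
have w0 : 0 <= u / v by rewrite mulr_ge0// ltW.
have uE : u = v * (u / v) by rewrite mulrCA divff ?mulr1// gt_eqF.
have sE : (u - v) / v = u / v - 1 by rewrite mulrBl divff// gt_eqF.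
have uP (b : R) : u `^ b = v `^ b * (u / v) `^ b.
  by rewrite -powRM ?(ltW v0)// -uE.
rewrite /falpha /falpha_slope.
have [a0|a0] := ltP 0 alpha; last first.
  have -> : (Num.sqrt v == 0) = false by rewrite gt_eqF// sqrtr_gt0.
  (* Coinciding points give [-oo] on the left when [alpha <= 0]. *)
  have [->|] := eqVneq u 0; first by rewrite sqrtr0 eqxx leNye.
  move=> un0; have up : 0 < u by rewrite lt_neqAle eq_sym un0.
  have -> : (Num.sqrt u == 0) = false by rewrite gt_eqF// sqrtr_gt0.
  have wp : 0 < u / v by rewrite mulr_gt0.
  have [_|an0] := eqVneq alpha 0.
    rewrite -EFinD lee_fin -!powR12_sqrt ?(ltW v0)// !ln_powR.
    have := ln_le_subr1 wp; rewrite ln_div ?posrE// -sE.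
    by rewrite -[2^-1 / v * _]mulrA [v^-1 * _]mulrC; lra.
  have {}a0 : alpha < 0 by rewrite lt_neqAle an0.
  rewrite -EFinD lee_fin !sqrtr_powR ?(ltW v0)// uP.
  rewrite -[_ / v * _]mulrA [v^-1 * _]mulrC sE ltr0_norm//.
  have b0 : alpha / 2 < 0 by lra.
  have := ler_wpM2l (powR_ge0 v (alpha / 2)) (powR_bernoulli_ge b0 wp).
  by set V := v `^ _; set w := u / v; set W := w `^ _; lra.
rewrite (gt_eqF a0) -EFinD lee_fin !sqrtr_powR ?(ltW v0)// uP.
rewrite -[_ / v * _]mulrA [v^-1 * _]mulrC sE gtr0_norm//.
have b0 : 0 < alpha / 2 by lra.
have b1 : alpha / 2 <= 1 by lra.
have := ler_wpM2l (powR_ge0 v (alpha / 2)) (powR_bernoulli_le b0 b1 w0).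
by set V := v `^ _; set w := u / v; set W := w `^ _; lra.
Qed.

(** The squared chord between two vertices of the regular polygon of edge 1, see
    [sqdist_regular_ngon]; the square absorbs the sign of [p - q]. *)
Definition chord2 (R : realType) (n : nat) (p q : 'I_n) : R :=
  (sin ((p%:R - q%:R) * (pi / n%:R)) / sin (pi / n%:R)) ^+ 2.

Definition sqdist (R : realType) (x y : 'rV[R]_2) : R :=
  \sum_(k < 2) (x 0 k - y 0 k) ^+ 2.

Lemma sqdistE (R : realType) (x y : 'rV[R]_2) :
  sqdist x y = (x 0 0 - y 0 0) ^+ 2 + (x 0 1 - y 0 1) ^+ 2.
Proof.
rewrite /sqdist !big_ord_recl big_ord0 addr0.
by congr (_ + (x 0 _ - y 0 _) ^+ 2); apply: val_inj.
Qed.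

Lemma sqdist_ge0 (R : realType) (x y : 'rV[R]_2) : 0 <= sqdist x y.
Proof. by rewrite sumr_ge0// => k _; rewrite sqr_ge0. Qed.

Lemma eucl_dist_sqr (R : realType) (x y : 'rV[R]_2) :
  eucl_dist x y ^+ 2 = sqdist x y.
Proof. by rewrite sqr_sqrtr// sqdist_ge0. Qed.

Lemma sqdistC (R : realType) (x y : 'rV[R]_2) : sqdist x y = sqdist y x.
Proof. by apply: eq_bigr => k _; rewrite -sqrrN opprB. Qed.

Lemma sqdistxx (R : realType) (x : 'rV[R]_2) : sqdist x x = 0.
Proof. by apply: big1 => k _; rewrite subrr expr0n. Qed.

Lemma sin_pin_gt0 (R : realType) (n : nat) : (1 < n)%N -> 0 < sin (pi / n%:R) :> R.
Proof. by move=> n1; have := @sin_pidiv_gt0 R n 1 erefl n1; rewrite mul1r. Qed.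

Lemma regular_ngonE (R : realType) (n : nat) (p : 'I_n) :
  let r : R := (2 * sin (pi / n%:R))^-1 in
  let t : R := p%:R * (2 * pi / n%:R) in
  (@regular_ngon R n p 0 0 = r * cos t) * (@regular_ngon R n p 0 1 = r * sin t).
Proof.
move=> r t; rewrite /regular_ngon !mxE/= -/r.
by have -> : 2 * pi * p%:R / n%:R = t by rewrite /t; ring.
Qed.

Lemma sqdist_regular_ngon (R : realType) (n : nat) (p q : 'I_n) : (1 < n)%N ->
  sqdist (@regular_ngon R n p) (@regular_ngon R n q) = chord2 R p q.
Proof.
move=> n1; rewrite sqdistE !regular_ngonE/= /chord2.
set h : R := (_ - _) * _; set t := q%:R * _; set s := sin (pi / _).
have -> : p%:R * (2 * pi / n%:R) = t + h *+ 2 by rewrite /t /h; ring.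
rewrite (cosD t) (sinD t) cos_mulr2n sin_mulr2n.
have s0 : s != 0 by rewrite gt_eqF// sin_pin_gt0.
have := cos2Dsin2 h; have := cos2Dsin2 t.
set ct := cos t; set st := sin t; set ch := cos h; set sh := sin h => e1 e2.
have c2 : ch ^+ 2 = 1 - sh ^+ 2 by rewrite -e2; ring.
have t2 : ct ^+ 2 = 1 - st ^+ 2 by rewrite -e1; ring.
rewrite c2; transitivity ((s ^- 2) * sh ^+ 2 * (sh ^+ 2 + ch ^+ 2) * (st ^+ 2 + ct ^+ 2)).
  by field.
by rewrite c2 t2; field.
Qed.

(** * Extremal property of the first harmonic *)

Definition spectrum (R : realType) (n : nat) (A : 'I_n -> 'rV[R]_2) (m : nat) : R :=
  power_spectrum (fun j => A j 0 0) m + power_spectrum (fun j => A j 0 1) m.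

Lemma power_spectrum_ge0 (R : realType) (n : nat) (x : 'I_n -> R) (m : nat) :
  0 <= power_spectrum x m.
Proof. by rewrite addr_ge0// sqr_ge0. Qed.

Lemma spectrum_ge0 (R : realType) (n : nat) (A : 'I_n -> 'rV[R]_2) (m : nat) :
  0 <= spectrum A m.
Proof. by rewrite addr_ge0// power_spectrum_ge0. Qed.

Lemma power_spectrum_eq0 (R : realType) (n : nat) (x : 'I_n -> R) (m : nat) :
  power_spectrum x m = 0 -> fourier_cos x m = 0 /\ fourier_sin x m = 0.
Proof.
move/eqP; rewrite paddr_eq0 ?sqr_ge0// !sqrf_eq0 => /andP[/eqP-> /eqP->].
by [].
Qed.

Lemma sum_sqdist_shift (R : realType) (n k : nat) (A : 'I_n.+1 -> 'rV[R]_2) :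
  n.+1%:R * \sum_(j < n.+1) sqdist (A (j + inZp k)) (A j) =
  4 * \sum_(m < n.+1) sin (k%:R * (m%:R * (pi / n.+1%:R))) ^+ 2 * spectrum A m.
Proof.
under eq_bigr do rewrite sqdistE.
rewrite big_split mulrDr.
rewrite (sum_sqr_shift_diff k (fun j => A j 0 0)).
rewrite (sum_sqr_shift_diff k (fun j => A j 0 1)).
rewrite -mulrDr -big_split/=; congr (_ * _).
by apply: eq_bigr => m _; rewrite -mulrDr.
Qed.

Lemma ordS_shift (n : nat) (i : 'I_n.+1) : ordS i = i + inZp 1.
Proof. by apply: val_inj; rewrite /= modnDmr addn1. Qed.

Lemma sum_sqdist_edges (R : realType) (n : nat) (A : 'I_n.+1 -> 'rV[R]_2) :
  unit_edges A -> \sum_(j < n.+1) sqdist (A (j + inZp 1)) (A j) = n.+1%:R.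
Proof.
move=> uA; under eq_bigr do rewrite -ordS_shift sqdistC -eucl_dist_sqr uA expr1n.
by rewrite sumr_const card_ord.
Qed.

Section unit_polygon.
Variables (R : realType) (n : nat) (A : 'I_n.+1 -> 'rV[R]_2).
Hypotheses (n0 : (0 < n)%N) (uA : unit_edges A).
Let N := n.+1.
Let a : R := pi / N%:R.

Let sina : 0 < sin a. Proof. exact: sin_pin_gt0. Qed.
Let NR : 0 < N%:R :> R. Proof. by rewrite ltr0n. Qed.

(** For shift 1, Parseval turns the unit edges into [N^2 = 4 sum_m sin^2 (m a) P_m]. Replacing [N^2]
    by this sum merges both terms into one spectral sum, whose brackets are nonnegative by
    [sin2_ratio_le]. *)
Lemma chord_defect (k : nat) :
  N%:R * (N%:R * (sin (k%:R * a) / sin a) ^+ 2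
          - \sum_(j < N) sqdist (A (j + inZp k)) (A j)) =
  4 / sin a ^+ 2 *
  \sum_(m < N) (sin (k%:R * a) ^+ 2 * sin (m%:R * a) ^+ 2 -
    sin (k%:R * (m%:R * a)) ^+ 2 * sin a ^+ 2) * spectrum A m.
Proof.
have S1 := sum_sqdist_shift 1 A; rewrite sum_sqdist_edges// in S1.
rewrite mulrBr sum_sqdist_shift mulrA S1.
under [X in _ = _ * X]eq_bigr do rewrite mulrBl.
have s0 : sin a != 0 by rewrite gt_eqF.
rewrite sumrB mulrBr; congr (_ - _).
  rewrite expr_div_n -mulrA mulr_suml mulr_sumr [RHS]mulr_sumr.
  by apply: eq_bigr => m _; rewrite mul1r -/a; field.
rewrite mulr_sumr [RHS]mulr_sumr.
by apply: eq_bigr => m _; rewrite -/a; field.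
Qed.

Lemma sum_sqdist_shift_le (k : nat) : (0 < k)%N -> (k < N)%N ->
  \sum_(j < N) sqdist (A (j + inZp k)) (A j) <=
  N%:R * (sin (k%:R * a) / sin a) ^+ 2.
Proof.
move=> k0 kN; rewrite -subr_ge0 -(pmulr_rge0 _ NR) chord_defect.
rewrite mulr_ge0 ?divr_ge0 ?sqr_ge0//; apply: sumr_ge0 => m _.
by rewrite mulr_ge0 ?spectrum_ge0// subr_ge0 sin2_ratio_le// ltnW.
Qed.

(** For [k = 2] the bracket in [chord_defect] equals [4 sin^2 a sin^2 (m a) (cos^2 a - cos^2 (m
    a))]. It is positive for [1 < m < n = N - 1], because then [a < m a < pi - a]; so a zero defect
    forces [P_m = 0]. *)
Lemma extremal_spectrum (m : nat) :
  \sum_(j < N) sqdist (A (j + inZp 2)) (A j) = N%:R * (sin (2%:R * a) / sin a) ^+ 2 ->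
  (1 < m)%N -> (m < n)%N -> spectrum A m = 0.
Proof.
move=> E m1 mn; have N2 : (2 < N)%N by rewrite ltnS (ltn_trans m1 mn).
have mN : (m < N)%N by exact: ltnW.
have /eqP := chord_defect 2; rewrite E subrr mulr0 eq_sym mulf_eq0.
rewrite gt_eqF ?divr_gt0 ?exprn_gt0//= psumr_eq0; last first.
  move=> i _; rewrite mulr_ge0 ?spectrum_ge0// subr_ge0 sin2_ratio_le//.
  exact: ltnW.
move=> /allP/(_ (Ordinal mN) (mem_index_enum _))/=.
rewrite mulf_eq0 => /orP[|/eqP//].
rewrite ![2%:R * _]mulr_natl !sin_mulr2n => /eqP E0; exfalso.
have am : a < m%:R * a.
  by rewrite ltr_pMl ?ltr1n// divr_gt0// pi_gt0.
have am' : m%:R * a < pi - a.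
  have -> : pi - a = n%:R * a.
    rewrite /a /N -natr1; have : n%:R + 1 != 0 :> R by rewrite natr1.
    by move=> ?; field.
  by rewrite ltr_pM2r ?ltr_nat// divr_gt0// pi_gt0.
have a0 : 0 < a by rewrite divr_gt0// pi_gt0.
have sm : 0 < sin (m%:R * a) by apply: sin_gt0_pi; lra.
have c1 : cos (m%:R * a) < cos a.
  by rewrite ltr_cos// in_itv/=; apply/andP; split; lra.
have c2 : - cos a < cos (m%:R * a).
  have -> : - cos a = cos (pi - a) by rewrite cosB cospi sinpi; ring.
  by rewrite ltr_cos// in_itv/=; apply/andP; split; lra.
have sa : 0 < sin a := sina; move: E0.
set c := cos a in c1 c2 *; set s := sin a in sa *.
set c' := cos _ in c1 c2 *; set s' := sin _ in sm *.
have -> : ((c * s) *+ 2) ^+ 2 * s' ^+ 2 - ((c' * s') *+ 2) ^+ 2 * s ^+ 2 =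
  4 * s ^+ 2 * s' ^+ 2 * ((c - c') * (c + c')) by ring.
apply/eqP; rewrite gt_eqF// !mulr_gt0// ?exprn_gt0//; lra.
Qed.

End unit_polygon.

(** Only the frequencies 0, 1 and [M + 2 = N - 1] survive in the inversion formula; the last one has
    the same cosine as frequency 1 and the opposite sine, so the two merge. *)
Lemma first_harmonic_coord (R : realType) (M : nat) (x : 'I_M.+3 -> R) :
  (forall m, (1 < m)%N -> (m < M.+2)%N -> power_spectrum x m = 0) ->
  exists c u v : R, forall j, x j =
    c + u * cos (j%:R * (2 * pi / M.+3%:R)) + v * sin (j%:R * (2 * pi / M.+3%:R)).
Proof.
move=> P0; set N := M.+3.
have N0 : N%:R != 0 :> R by rewrite pnatr_eq0.
exists (fourier_cos x 0 / N%:R),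
  ((fourier_cos x 1 + fourier_cos x M.+2) / N%:R),
  ((fourier_sin x 1 - fourier_sin x M.+2) / N%:R) => j.
apply: (mulfI N0); rewrite -fourier_inversion big_ord_recr/= big_ord_recl/=.
rewrite big_ord_recl/= big1 => [|i _]; last first.
  have [-> ->] := power_spectrum_eq0 (P0 i.+2 isT (ltn_ord i)).
  by rewrite !mul0r addr0.
rewrite mul0r cos0 sin0 /bump/= add1n mul1r; set t := j%:R * _.
have -> : M.+2%:R * t = - t + j%:R * (2 * pi).
  have -> : M.+2%:R = N%:R - 1 :> R by rewrite /N -[M.+3%:R]natr1 addrK.
  by rewrite /t; field.
by rewrite cosD2piMn sinD2piMn cosN sinN; field.
Qed.

Lemma first_harmonic_congruent (R : realType) (M : nat) (A : 'I_M.+3 -> 'rV[R]_2) :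
  (1 < M)%N -> unit_edges A ->
  (forall m, (1 < m)%N -> (m < M.+2)%N -> spectrum A m = 0) ->
  congruent A (@regular_ngon R M.+3).
Proof.
move=> M1 uA S0; set N := M.+3.
have NR : 0 < N%:R :> R by rewrite ltr0n.
have [c1 [u1 [v1 xE]]] : exists c u v : R, forall j, A j 0 0 =
    c + u * cos (j%:R * (2 * pi / M.+3%:R)) + v * sin (j%:R * (2 * pi / M.+3%:R)).
  apply: first_harmonic_coord => m m1 mM; have /eqP := S0 m m1 mM.
  by rewrite paddr_eq0 ?power_spectrum_ge0// => /andP[/eqP].
have [c2 [u2 [v2 yE]]] : exists c u v : R, forall j, A j 0 1 =
    c + u * cos (j%:R * (2 * pi / M.+3%:R)) + v * sin (j%:R * (2 * pi / M.+3%:R)).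
  apply: first_harmonic_coord => m m1 mM; have /eqP := S0 m m1 mM.
  by rewrite paddr_eq0 ?power_spectrum_ge0// => /andP[_ /eqP].
pose h : R := pi / N%:R; pose s := sin h.
have s0 : 0 < s by exact: sin_pin_gt0.
(* These are the Gram entries of the vectors [u] and [v]; the goal is [r = 0] and
   [p = q = 1 / (2 s)^2]. *)
pose p := u1 ^+ 2 + u2 ^+ 2; pose q := v1 ^+ 2 + v2 ^+ 2; pose r := u1 * v1 + u2 * v2.
have phiE : 2 * pi / N%:R = h *+ 2 by rewrite /h; ring.
(* The squared edge length is a quadratic form in the sine and cosine of the angle [t] halfway
   between the two vertices. The mid-angles [h], [- h] (last edge, modulo a turn) and [3 h] suffice
   below. *)
have edge (j : 'I_N) (t := j%:R * (h *+ 2) + h) :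
    4 * s ^+ 2 * (p * sin t ^+ 2 + q * cos t ^+ 2 - 2 * r * sin t * cos t) = 1.
  have step : (ordS j)%:R * (h *+ 2) = t + h
      \/ (ordS j)%:R * (h *+ 2) = t + h - 1%:R * (2 * pi).
    rewrite /t /=; have := ltn_ord j; rewrite -/N leq_eqVlt => /predU1P[jN|jN].
      right; rewrite jN modnn; have <- : N%:R * (h *+ 2) = 1 * (2 * pi).
        by rewrite /h; field; rewrite gt_eqF.
      by rewrite -[in N%:R]jN -natr1; ring.
    by left; rewrite modn_small// -natr1; ring.
  have [cE sE] : cos ((ordS j)%:R * (h *+ 2)) = cos (t + h) /\
      sin ((ordS j)%:R * (h *+ 2)) = sin (t + h).
    case: step => ->; first by [].
    by rewrite -(cosD2piMn 1) -(sinD2piMn 1) subrK.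
  have := uA j.
  move=> /(congr1 (fun z => z ^+ 2)); rewrite expr1n eucl_dist_sqr sqdistE.
  rewrite !xE !yE phiE cE sE.
  have -> : j%:R * (h *+ 2) = t - h by rewrite /t addrK.
  rewrite !(cosD t) !(sinD t) cosN sinN -/s => E.
  by rewrite -[RHS]E /p /q /r; ring.
have e0 : 4 * s ^+ 2 * (p * sin h ^+ 2 + q * cos h ^+ 2 - 2 * r * sin h * cos h) = 1.
  by have := edge ord0; rewrite /= mul0r add0r.
have eM : 4 * s ^+ 2 * (p * sin h ^+ 2 + q * cos h ^+ 2 + 2 * r * sin h * cos h) = 1.
  have := edge ord_max; rewrite /=.
  have -> : M.+2%:R * (h *+ 2) + h = - h + 1%:R * (2 * pi).
    have -> : M.+2%:R = N%:R - 1 :> R by rewrite /N -[M.+3%:R]natr1 addrK.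
    by rewrite /h; field; rewrite gt_eqF.
  by rewrite sinD2piMn cosD2piMn sinN cosN => E; rewrite -[RHS]E; ring.
have e1 : 4 * s ^+ 2 * (p * sin (h *+ 3) ^+ 2 + q * cos (h *+ 3) ^+ 2 -
    2 * r * sin (h *+ 3) * cos (h *+ 3)) = 1.
  have := edge (inord 1); rewrite inordK//.
  by have -> : 1 * (h *+ 2) + h = h *+ 3 by ring.
have h0 : 0 < h by rewrite divr_gt0// pi_gt0.
have h4 : h *+ 4 < pi.
  by rewrite -[_ *+ 4]mulr_natl /h mulrCA gtr_pMr ?pi_gt0// ltr_pdivrMr// mul1r ltr_nat.
have h02 : h < pi / 2 by lra.
have ch : 0 < cos h by apply: cos_gt0_pihalf; lra.
(* The edges at [h] and [- h] differ only in the sign of the mixed term. *)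
have r0 : r = 0.
  apply/eqP; have : 16 * s ^+ 2 * s * cos h * r = 0.
    by rewrite /s; move: e0 eM; rewrite /s; lra.
  by move/eqP; rewrite mulf_eq0 gt_eqF// !mulr_gt0// exprn_gt0.
(* With [r = 0], comparing the edges at [h] and [3 h] leaves [(p - q) sin (4 h) sin (2 h) = 0]. Here
   [4 h < pi], that is [N > 4], is decisive: for a quadrilateral [sin (4 h)] vanishes. *)
have pq : p = q.
  have c2h : cos (h *+ 2) != 0.
    rewrite gt_eqF// cos_gt0_pihalf//; lra.
  have s2h : 0 < sin (h *+ 2) by apply: sin_gt0_pi; lra.
  have sE : sin (h *+ 3) = sin (h *+ 2) * cos h + cos (h *+ 2) * s.
    by rewrite mulrSr sinD.
  have sE' : s = sin (h *+ 2) * cos h - cos (h *+ 2) * s.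
    by rewrite -sinB mulr2n addrK.
  have : 4 * s ^+ 2 * ((p - q) * (sin (h *+ 3) ^+ 2 - s ^+ 2)) = 0.
    have := cos2sin2 (h *+ 3); have := cos2sin2 h; rewrite -/s => ch2 c3h2.
    by move: e0 e1; rewrite r0 ch2 c3h2 -/s; lra.
  have -> : sin (h *+ 3) ^+ 2 - s ^+ 2 =
      4 * (cos (h *+ 2) * s * (sin (h *+ 2) * cos h)).
    rewrite subr_sqr (_ : _ - s = 2 * (cos (h *+ 2) * s)); last by lra.
    by rewrite (_ : _ + s = 2 * (sin (h *+ 2) * cos h)); [ring|lra].
  move/eqP; rewrite !mulf_eq0 subr_eq0 (gt_eqF s2h) (gt_eqF ch) (gt_eqF s0).
  by rewrite (negbTE c2h) pnatr_eq0/= ?orbF => /eqP.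
have sp : 4 * s ^+ 2 * p = 1.
  by rewrite -[RHS]e0 r0 -pq (sin2cos2 h); ring.
have uu : u1 ^+ 2 + u2 ^+ 2 = (2 * s) ^- 2.
  have s20 : (2 * s) ^+ 2 != 0 by rewrite gt_eqF// exprn_gt0// mulr_gt0.
  by apply: (mulfI s20); rewrite divff// -[RHS]sp -/p; ring.
have vv : v1 ^+ 2 + v2 ^+ 2 = (2 * s) ^- 2 by rewrite -/q -pq.
(* The factor [2 s] cancels the circumradius [1 / (2 s)], so the linear part has the orthonormal
   columns [2 s u] and [2 s v]. *)
pose f (z : 'rV[R]_2) : 'rV[R]_2 := \row_(k < 2)
  (if k == 0 then c1 + (u1 * z 0 0 + v1 * z 0 1) * (2 * s)
   else c2 + (u2 * z 0 0 + v2 * z 0 1) * (2 * s)).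
exists f; split=> [x y|i].
  rewrite /eucl_dist; congr Num.sqrt; rewrite -!/(sqdist _ _) !sqdistE !mxE/=.
  have uv : u1 * v1 + u2 * v2 = 0 by [].
  transitivity ((u1 ^+ 2 + u2 ^+ 2) * (2 * s) ^+ 2 * (x 0 0 - y 0 0) ^+ 2 +
    (v1 ^+ 2 + v2 ^+ 2) * (2 * s) ^+ 2 * (x 0 1 - y 0 1) ^+ 2 +
    2 * (u1 * v1 + u2 * v2) * (2 * s) ^+ 2 * (x 0 0 - y 0 0) * (x 0 1 - y 0 1)).
    by ring.
  by rewrite uu vv uv; field; rewrite gt_eqF.
apply/matrixP => o k; rewrite (ord1 o) mxE !regular_ngonE/= -/s.
have s2 : s != 0 by rewrite gt_eqF.
have [->|] := eqVneq k 0; first by rewrite xE; field.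
case: k => [[|[|//]]] k2 // _.
have -> : Ordinal k2 = 1 by apply: val_inj.
by rewrite yE; field.
Qed.

(** * Energy *)

Lemma chord2C (R : realType) (n : nat) (p q : 'I_n) : chord2 R p q = chord2 R q p.
Proof. by rewrite /chord2 -opprB mulNr sinN mulNr sqrrN. Qed.

Lemma chord2xx (R : realType) (n : nat) (p : 'I_n) : chord2 R p p = 0.
Proof. by rewrite /chord2 subrr mul0r sin0 mul0r expr0n. Qed.

Lemma chord2_gt0 (R : realType) (n : nat) (p q : 'I_n) :
  p != q -> 0 < chord2 R p q.
Proof.
wlog pq : p q / (q < p)%N => [wl|_].
  by rewrite -val_eqE neq_ltn => /orP[] h; [rewrite chord2C|]; apply: wl;
    rewrite // -val_eqE neq_ltn h ?orbT.
have n1 : (1 < n)%N by apply: leq_ltn_trans (ltn_ord p); exact: leq_ltn_trans pq.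
rewrite /chord2 exprn_gt0// divr_gt0 ?sin_pin_gt0// -natrB 1?ltnW//.
by rewrite sin_pidiv_gt0 ?subn_gt0// (leq_ltn_trans (leq_subr _ _)).
Qed.

(** Wrapping the index around moves the angle by a multiple of [pi], which the squared sine does not
    see. *)
Lemma chord2_shift (R : realType) (n k : nat) (p : 'I_n.+1) :
  chord2 R (p + inZp k) p = (sin (k%:R * (pi / n.+1%:R)) / sin (pi / n.+1%:R)) ^+ 2.
Proof.
rewrite /chord2 !expr_div_n; congr (_ / _).
rewrite -(sin2_addpi ((p + k) %/ n.+1)); congr (sin _ ^+ 2).
have nR : n.+1%:R != 0 :> R by rewrite pnatr_eq0.
have : (p + k)%:R = ((p + k) %/ n.+1)%:R * n.+1%:R + ((p + inZp k : 'I_n.+1)%R : nat)%:R :> R.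
  by rewrite val_shift -natrM -natrD -divn_eq.
rewrite natrD => /(canRL (addrK _)) ->.
by move: (_ %/ _)%:R => d; field.
Qed.

Lemma regular_ngon_unit_edges (R : realType) (n : nat) :
  (1 < n)%N -> unit_edges (@regular_ngon R n).
Proof.
case: n => // n n1 i; rewrite /eucl_dist -/(sqdist _ _) sqdist_regular_ngon//.
by rewrite chord2C ordS_shift chord2_shift mul1r divff ?expr1n ?sqrtr1// gt_eqF// sin_pin_gt0.
Qed.

Lemma sum_sym_upper (R : comPzRingType) (n : nat) (F : 'I_n -> 'I_n -> R) :
  (forall p q, F p q = F q p) -> (forall p, F p p = 0) ->
  \sum_(p < n) \sum_(q < n) F p q = 2 * \sum_(p < n) \sum_(q < n | (p < q)%N) F p q.
Proof.
move=> FC F0.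
have -> : \sum_(p < n) \sum_(q < n) F p q =
    \sum_(p < n) (\sum_(q < n | (p < q)%N) F p q + \sum_(q < n | (q < p)%N) F p q).
  apply: eq_bigr => p _; rewrite (bigD1 p)//= F0 add0r.
  rewrite (bigID (fun q : 'I_n => (p < q)%N))/=; congr (_ + _); apply: eq_bigl => q.
    by rewrite -val_eqE/= neq_ltn; case: ltngtP.
  by rewrite -val_eqE/= neq_ltn; case: ltngtP.
rewrite big_split/= [X in _ + X](exchange_big_dep xpredT)//=.
rewrite mulr_natl mulr2n; congr (_ + _).
by apply: eq_bigr => p _; apply: eq_bigr.
Qed.

(** The first-order bound, from the tangents at the regular chords, for the energy of [A] minus that
    of the regular polygon. *)
Definition energy_defect (R : realType) (n : nat) (alpha : R)
    (A : 'I_n -> 'rV[R]_2) : R :=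
  \sum_(p < n) \sum_(q < n | (p < q)%N) falpha_slope alpha (chord2 R p q) *
    (sqdist (A p) (A q) - chord2 R p q).

(** Finiteness allows this energy to be cancelled in inequalities between extended reals. *)
Lemma energy_regular_ngon_fin (R : realType) (n : nat) (alpha : R) :
  energy alpha (@regular_ngon R n) \is a fin_num.
Proof.
apply/sum_fin_numP => p _ _; apply/sum_fin_numP => q _ pq.
have n1 : (1 < n)%N by apply: leq_ltn_trans (ltn_ord q); exact: leq_ltn_trans pq.
rewrite falpha_fin// sqrtr_gt0 -/(sqdist _ _) sqdist_regular_ngon// chord2_gt0//.
by rewrite -val_eqE neq_ltn pq.
Qed.

Lemma energy_le_tangent (R : realType) (n : nat) (alpha : R) (A : 'I_n -> 'rV[R]_2) :
  alpha <= 2 ->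
  (energy alpha A <= energy alpha (@regular_ngon R n) + (energy_defect alpha A)%:E)%E.
Proof.
move=> a2; rewrite /energy_defect -sumEFin -big_split/=.
apply: lee_sum => p _; rewrite -sumEFin -big_split/=.
apply: lee_sum => q pq; rewrite /eucl_dist -!/(sqdist _ _).
have n1 : (1 < n)%N by apply: leq_ltn_trans (ltn_ord q); exact: leq_ltn_trans pq.
rewrite sqdist_regular_ngon// falpha_sqrt_le_tangent ?sqdist_ge0// chord2_gt0//.
by rewrite -val_eqE neq_ltn pq.
Qed.

(** Pairs are grouped by their cyclic difference [k], on which alone the chord and the slope depend;
    the factor 2 comes from counting ordered pairs. *)
Lemma energy_defectE (R : realType) (n : nat) (alpha : R) (A : 'I_n.+1 -> 'rV[R]_2)
    (v := fun k : nat => (sin (k%:R * (pi / n.+1%:R)) / sin (pi / n.+1%:R)) ^+ 2 : R) :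
  2 * energy_defect alpha A =
  \sum_(k < n.+1) falpha_slope alpha (v k) *
    (\sum_(p < n.+1) sqdist (A (p + inZp k)) (A p) - n.+1%:R * v k).
Proof.
rewrite -sum_sym_upper; last 2 first.
- by move=> p q; rewrite chord2C sqdistC.
- by move=> p; rewrite chord2xx sqdistxx subrr mulr0.
rewrite exchange_big/=.
transitivity (\sum_(q < n.+1) \sum_(k < n.+1) falpha_slope alpha (v k) *
    (sqdist (A (q + inZp k)) (A q) - v k)).
  apply: eq_bigr => q _; rewrite (reindex_inj (addrI q)).
  by apply: eq_bigr => k _; rewrite -[k in LHS]valZpK chord2_shift.
rewrite exchange_big/=; apply: eq_bigr => k _; rewrite -mulr_sumr sumrB.
by rewrite sumr_const card_ord mulr_natl.
Qed.

Lemma energy_defect_term_le0 (R : realType) (n : nat) (alpha : R)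
    (A : 'I_n.+1 -> 'rV[R]_2) (k : 'I_n.+1)
    (v := fun k : nat => (sin (k%:R * (pi / n.+1%:R)) / sin (pi / n.+1%:R)) ^+ 2 : R) :
  (0 < n)%N -> unit_edges A ->
  falpha_slope alpha (v k) *
    (\sum_(p < n.+1) sqdist (A (p + inZp k)) (A p) - n.+1%:R * v k) <= 0.
Proof.
move=> n0 uA; have [k0|k0] := posnP k.
  (* For [k = 0] the chord vanishes and the slope need not be positive, but the bracket is zero. *)
  rewrite /v k0 mul0r sin0 mul0r expr0n/= mulr0 subr0 big1 ?mulr0// => p _.
  rewrite (_ : inZp 0 = 0) ?addr0 ?sqdistxx//; exact: val_inj.
have vk : 0 < v k.
  by rewrite exprn_gt0// divr_gt0 ?sin_pidiv_gt0 ?sin_pin_gt0.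
rewrite pmulr_rle0 ?falpha_slope_gt0// subr_le0.
exact: sum_sqdist_shift_le.
Qed.

Lemma energy_defect_le0 (R : realType) (n : nat) (alpha : R) (A : 'I_n -> 'rV[R]_2) :
  (1 < n)%N -> unit_edges A -> energy_defect alpha A <= 0.
Proof.
case: n A => // n A n0 uA.
rewrite -(pmulr_rle0 _ (ltr0Sn R 1)) energy_defectE sumr_le0// => k _.
exact: energy_defect_term_le0.
Qed.

Lemma energy_le_regular_ngon (R : realType) (n : nat) (alpha : R)
    (A : 'I_n -> 'rV[R]_2) : alpha <= 2 -> (1 < n)%N -> unit_edges A ->
  (energy alpha A <= energy alpha (@regular_ngon R n))%E.
Proof.
move=> a2 n1 uA; apply: le_trans (energy_le_tangent A a2) _.
by rewrite -[leRHS]adde0 leeD2l// lee_fin energy_defect_le0.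
Qed.

(** Maximality and the tangent bound make the defect nonnegative, while all its terms are
    nonpositive; so every term vanishes. The one for [k = 2], having a positive slope, is the
    equality needed by [extremal_spectrum]. *)
Lemma energy_max_congruent (R : realType) (n : nat) (alpha : R)
    (A : 'I_n -> 'rV[R]_2) : alpha <= 2 -> (4 < n)%N -> unit_edges A ->
  (energy alpha (@regular_ngon R n) <= energy alpha A)%E ->
  congruent A (@regular_ngon R n).
Proof.
case: n A => [|[|[|M]]]// A a2 M1 uA regA.
apply: first_harmonic_congruent => // m m1 mM.
apply: extremal_spectrum => //.
have D0 : 0 <= energy_defect alpha A.
  have := le_trans regA (energy_le_tangent A a2).
  by rewrite -{1}[energy _ _]adde0 leeD2lE ?energy_regular_ngon_fin// lee_fin.
have := energy_defectE alpha A.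
set v := fun k : nat => _ => DE.
have DE0 : \sum_(k < M.+3) falpha_slope alpha (v k) *
    (\sum_(p < M.+3) sqdist (A (p + inZp k)) (A p) - M.+3%:R * v k) = 0.
  apply/eqP; rewrite eq_le -{2}DE mulr_ge0// andbT sumr_le0// => k _.
  exact: energy_defect_term_le0.
have /eqP := DE0; rewrite -oppr_eq0 -sumrN psumr_eq0; last first.
  by move=> k _; rewrite oppr_ge0; exact: energy_defect_term_le0.
move=> /allP/(_ (inord 2) (mem_index_enum _))/=.
rewrite inordK// oppr_eq0 mulf_eq0 gt_eqF/=; last first.
  by rewrite falpha_slope_gt0// exprn_gt0// divr_gt0 ?sin_pidiv_gt0 ?sin_pin_gt0.
by rewrite subr_eq0 => /eqP.
Qed.

Lemma energy_congruent (R : realType) (n : nat) (alpha : R)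
    (A B : 'I_n -> 'rV[R]_2) : congruent A B -> energy alpha A = energy alpha B.
Proof.
case=> f [fd fE]; apply: eq_bigr => p _; apply: eq_bigr => q _.
by rewrite !fE fd.
Qed.

(** * Convexity of the regular polygon *)

(** Written in the standard basis so that continuity follows from that of sums and scalings. *)
Definition unit_vec (R : realType) (t : R) : 'rV[R]_2 :=
  cos t *: delta_mx 0 0 + sin t *: delta_mx 0 1.

Lemma unit_vecE (R : realType) (t : R) :
  (unit_vec t 0 0 = cos t) * (unit_vec t 0 1 = sin t).
Proof. by rewrite /unit_vec !mxE/= !(mulr1, mulr0, addr0, add0r). Qed.

Lemma scale_unit_vecE (R : realType) (s t : R) :
  ((s *: unit_vec t) 0 0 = s * cos t) * ((s *: unit_vec t) 0 1 = s * sin t).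
Proof. by rewrite ![(_ *: _ : 'rV_2) _ _]mxE !unit_vecE. Qed.

Lemma rV2P (R : realType) (x y : 'rV[R]_2) :
  x 0 0 = y 0 0 -> x 0 1 = y 0 1 -> x = y.
Proof.
move=> e0 e1; apply/matrixP => i k; rewrite (ord1 i).
have [->//|] := eqVneq k 0; case: k => [[|[|//]]] k2 // _.
by have -> : Ordinal k2 = 1 by exact: val_inj.
Qed.

Lemma polar_form (R : realType) (x : 'rV[R]_2) :
  exists2 rho : R, 0 <= rho &
  exists2 t : R, 0 <= t < 2 * pi & x = rho *: unit_vec t.
Proof.
have pi0 := pi_gt0 R.
pose rho2 := x 0 0 ^+ 2 + x 0 1 ^+ 2; pose rho := Num.sqrt rho2.
have rho20 : 0 <= rho2 by rewrite addr_ge0 ?sqr_ge0.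
exists rho; first exact: sqrtr_ge0.
have rhoE : rho ^+ 2 = rho2 by rewrite sqr_sqrtr.
have [r0|r0] := eqVneq rho 0.
  exists 0; first by rewrite lexx mulr_gt0.
  move: rhoE; rewrite r0 expr0n/= => /esym/eqP.
  rewrite paddr_eq0 ?sqr_ge0// !sqrf_eq0 => /andP[/eqP x0 /eqP x1].
  by apply: rV2P; rewrite scale0r mxE.
have rp : 0 < rho by rewrite lt_neqAle eq_sym r0 sqrtr_ge0.
pose c := x 0 0 / rho; pose s := x 0 1 / rho.
have xc : x 0 0 = rho * c by rewrite mulrC divfK.
have xs : x 0 1 = rho * s by rewrite mulrC divfK.
have cs : c ^+ 2 + s ^+ 2 = 1.
  by rewrite !expr_div_n -mulrDl -/rho2 -rhoE divff// expf_eq0.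
have c1 : -1 <= c <= 1.
  rewrite -ler_norml -(ler_sqr) ?nnegrE// real_normK ?num_real// expr1n -cs.
  by rewrite lerDl sqr_ge0.
have cacos : cos (acos c) = c by apply: acosK; rewrite in_itv.
have sacos : sin (acos c) = `|s|.
  by rewrite sin_acos// -cs addrC addKr sqrtr_sqr.
have [s0|s0] := leP 0 s.
  exists (acos c); first by rewrite acos_ge0//=; have := acos_lepi c1; lra.
  by apply: rV2P; rewrite mxE !unit_vecE ?cacos ?sacos// ger0_norm.
(* [acos] reaches only the upper half-plane, so the angle is reflected; [acos c] is nonzero since
   [s < 0], which keeps the result below [2 pi]. *)
exists (2 * pi - acos c).
  have : 0 < acos c.
    rewrite lt_neqAle acos_ge0// andbT; apply/eqP => ac0.
    by move: sacos; rewrite -ac0 sin0 => /esym/eqP; rewrite normr_eq0 lt_eqF.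
  by have := acos_lepi c1; lra.
have turn : 2 * pi - acos c = - acos c + 1%:R * (2 * pi) by ring.
apply: rV2P; rewrite mxE unit_vecE turn.
  by rewrite cosD2piMn cosN cacos.
by rewrite sinD2piMn sinN sacos ltr0_norm// opprK.
Qed.

(** Induction, giving weight [1 / (k + 2)] to the newest point; it serves to put the centre of the
    polygon into the hull. *)
Lemma convex_set_average (R : realType) (V : lmodType R) (D : set (convex_lmodType V))
    (f : nat -> V) (k : nat) :
  convex_set D -> (forall i, (i <= k)%N -> D (f i)) ->
  D (k.+1%:R^-1 *: \sum_(i < k.+1) f i).
Proof.
move=> cD; elim: k => [|k IH] fD.
  by rewrite big_ord1 invr1 scale1r; exact: fD.
have k2 : 0 <= (k.+2%:R^-1 : R) <= 1.
  by rewrite invr_ge0 ler0n invf_le1 ?ltr0n// ler1n.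
pose lam : {i01 R} := Itv01 (andP k2).1 (andP k2).2.
have fk1 : f k.+1 \in D by rewrite inE; exact: fD.
have avg : (k.+1%:R^-1 *: \sum_(i < k.+1) f i) \in D.
  by rewrite inE; apply: IH => i ik; apply: fD; exact: leqW.
have := cD _ _ lam fk1 avg; rewrite inE; congr D.
rewrite [in RHS]big_ord_recr/= scalerDr addrC; congr (_ + _).
rewrite /= scalerA; congr (_ *: _); rewrite /lam/= -[k.+2%:R]natr1.
have : k.+1%:R != 0 :> R by rewrite pnatr_eq0.
have : k.+1%:R + 1 != 0 :> R by rewrite natr1 pnatr_eq0.
by move=> ? ?; rewrite /unstable.onem; field; apply/andP.
Qed.

Lemma ler_cos_arc (R : realType) (a t : R) :
  0 <= a -> a <= t -> t <= 2 * pi - a -> cos t <= cos a.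
Proof.
move=> a0 at' t2; have [tpi|tpi] := leP t pi; first exact: ler_cos_0pi.
have -> : cos t = cos (2 * pi - t).
  have turn : t = (t - 2 * pi) + 1%:R * (2 * pi) by ring.
  by rewrite -[RHS]cosN opprB [in LHS]turn cosD2piMn.
by apply: ler_cos_0pi => //; lra.
Qed.

Section regular_ngon_convex.
Variables (R : realType) (n : nat).
Hypothesis n2 : (2 < n)%N.
Let a : R := pi / n%:R.
Let r : R := (2 * sin a)^-1.

Let nR0 : 0 < n%:R :> R. Proof. by rewrite ltr0n (ltn_trans _ n2). Qed.
Let nR : n%:R != 0 :> R. Proof. by rewrite gt_eqF. Qed.
Let na : n%:R * a = pi. Proof. by rewrite /a mulrC divfK. Qed.
Let a0 : 0 < a. Proof. by rewrite divr_gt0// pi_gt0. Qed.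
Let a3 : 3 * a <= pi. Proof. by rewrite -na ler_pM2r// ler_nat. Qed.
Let sina : 0 < sin a. Proof. by apply: sin_gt0_pi; have := a0; have := a3; lra. Qed.
Let cosa : 0 < cos a.
Proof. by apply: cos_gt0_pihalf; have := a0; have := a3; lra. Qed.
Let two_pi_sub : 2 * pi - a = n.*2.-1%:R * a.
Proof.
rewrite -subn1 natrB; last by have := n2; lia.
by rewrite -muln2 natrM -na; ring.
Qed.
Let r0 : 0 < r. Proof. by rewrite invr_gt0 mulr_gt0. Qed.
Let h0 : 0 < r * cos a. Proof. exact: mulr_gt0. Qed.

(* The outer normal of edge [j] has direction [(2 j + 1) pi / n]. *)
Definition edge_form (j : 'I_n) (x : 'rV[R]_2) : R :=
  x 0 0 * cos (j.*2.+1%:R * a) + x 0 1 * sin (j.*2.+1%:R * a).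

Lemma edge_form_linear (j : 'I_n) (s t : R) (x y : 'rV[R]_2) :
  edge_form j (s *: x + t *: y) = s * edge_form j x + t * edge_form j y.
Proof. by rewrite /edge_form !mxE; ring. Qed.

Lemma edge_formZ (j : 'I_n) (s : R) (x : 'rV[R]_2) :
  edge_form j (s *: x) = s * edge_form j x.
Proof. by rewrite /edge_form !mxE; ring. Qed.

Lemma edge_form_unit_vec (j : 'I_n) (t : R) :
  edge_form j (unit_vec t) = cos (t - j.*2.+1%:R * a).
Proof. by rewrite /edge_form !unit_vecE cosB. Qed.

Lemma edge_form_continuous (j : 'I_n) : continuous (edge_form j).
Proof.
move=> x; have c (k : 'I_2) (s : R) : {for x, continuous (fun y : 'rV[R]_2 => y 0 k * s)}.
  by apply: continuousM; [exact: coord_continuous|exact: cst_continuous].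
exact: (@continuousD R R^o _ _ _ _ (c 0 _) (c 1 _)).
Qed.

Lemma regular_ngon_polar (i : 'I_n) :
  regular_ngon R i = r *: unit_vec (i.*2%:R * a).
Proof.
have e : i%:R * (2 * pi / n%:R) = i.*2%:R * a.
  by rewrite -muln2 natrM /a; field.
by apply: rV2P; rewrite !regular_ngonE mxE unit_vecE e.
Qed.

(** Up to sign, the angle from a vertex to an edge normal is an odd multiple of [a] between [a] and
    [(2 n - 1) a], so its cosine is at most [cos a]. *)
Lemma edge_form_vertex_le (i j : 'I_n) :
  edge_form j (regular_ngon R i) <= r * cos a.
Proof.
rewrite regular_ngon_polar edge_formZ ler_pM2l// edge_form_unit_vec.
have arc (m : nat) : (0 < m)%N -> (m < n.*2)%N -> cos (m%:R * a) <= cos a.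
  move=> m0 mn; apply: ler_cos_arc; first exact: ltW.
    by rewrite -[leLHS]mul1r ler_pM2r// ler1n.
  by rewrite two_pi_sub ler_pM2r// ler_nat; lia.
have [ij|ji] := leqP i j.
  rewrite -cosN opprB -mulrBl -natrB; last by lia.
  by apply: arc; have := ltn_ord j; lia.
rewrite -mulrBl -natrB; last by lia.
by apply: arc; have := ltn_ord i; lia.
Qed.

Lemma edge_form_vertex (i : 'I_n) : edge_form i (regular_ngon R i) = r * cos a.
Proof.
rewrite regular_ngon_polar edge_formZ edge_form_unit_vec -cosN.
by rewrite opprB -natr1; congr (_ * cos _); ring.
Qed.

Lemma unit_vecD2pi (t : R) : unit_vec (t + 2 * pi) = unit_vec t.
Proof.
rewrite -[2 * pi]mul1r; apply: rV2P; rewrite !unit_vecE.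
  exact: (cosD2piMn 1).
exact: (sinD2piMn 1).
Qed.

Lemma regular_ngon_succ_polar (i : 'I_n) :
  regular_ngon R (ordS i) = r *: unit_vec (i.*2.+2%:R * a).
Proof.
rewrite regular_ngon_polar -doubleS /=; congr (_ *: _).
have := ltn_ord i; rewrite leq_eqVlt => /predU1P[->|iN].
  rewrite modnn mul0r -(unit_vecD2pi 0) add0r; congr unit_vec.
  by rewrite -na -muln2 natrM; ring.
by rewrite modn_small.
Qed.

(** The plane is cut into the [n] cones of angle [2 a] spanned by consecutive vertices. *)
Lemma polar_sector (x : 'rV[R]_2) :
  exists2 rho : R, 0 <= rho & exists j : 'I_n, exists2 t : R,
    0 <= t <= 2 * a & x = rho *: unit_vec (j.*2%:R * a + t).
Proof.
have [rho rho0 [t /andP[t0 t2] ->]] := polar_form x; exists rho => //.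
pose q := t / (2 * a).
have q0 : 0 <= q by rewrite divr_ge0// ltW// mulr_gt0.
have aa : 0 < 2 * a by rewrite mulr_gt0.
have jn : (Num.truncn q < n)%N.
  rewrite truncn_lt_nat// ltr_pdivrMr//.
  by rewrite mulrCA na.
exists (Ordinal jn); have /andP[h1 h2] := truncn_itv q0.
exists (t - (Num.truncn q).*2%:R * a); last by rewrite /= addrC subrK.
have e : (Num.truncn q).*2%:R * a = (Num.truncn q)%:R * (2 * a).
  by rewrite -muln2 natrM mulrA.
move: h1 h2; rewrite ler_pdivlMr// ltr_pdivrMr// e -natr1 => h1 h2.
by rewrite subr_ge0 h1/=; lra.
Qed.

(** * The hull of the regular polygon as an intersection of half-planes, and its boundary *)

Definition regular_region : set 'rV[R]_2 :=
  [set x | forall j, edge_form j x <= r * cos a].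

Lemma regular_region_convex : @convex_set R 'rV[R]_2 regular_region.
Proof.
move=> x y l; rewrite !inE => xK yK j.
rewrite edge_form_linear.
apply: (@le_trans _ _ (l%:num * (r * cos a) + (1 - l%:num) * (r * cos a))).
  by rewrite lerD// ler_wpM2l// ?ge0// subr_ge0 le1.
by rewrite -mulrDl addrC subrK mul1r.
Qed.

Lemma sum_regular_ngon : \sum_(i < n) regular_ngon R i = 0.
Proof.
have sumE (k : 'I_2) : (\sum_(i < n) regular_ngon R i) 0 k =
    \sum_(i < n) regular_ngon R i 0 k by rewrite summxE.
have n1 : (1 < n)%N by exact: ltn_trans n2.
apply: rV2P; rewrite mxE sumE.
  under eq_bigr do rewrite regular_ngonE; rewrite -mulr_sumr.
  have := @sum_cos_arith R n 1 0 erefl n1.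
  under eq_bigr do rewrite mul1r addr0.
  by move=> ->; rewrite mulr0.
under eq_bigr do rewrite regular_ngonE; rewrite -mulr_sumr.
(* The phase [- pi / 2] turns the cosines into sines. *)
have := @sum_cos_arith R n 1 (- (pi / 2)) erefl n1.
under eq_bigr do rewrite mul1r cosBpihalf.
by move=> ->; rewrite mulr0.
Qed.

(** For the harder inclusion, a point in the cone of edge [j] is [lam V_j + mu V_(j+1)] with
    nonnegative coefficients, and the constraint of edge [j] says [lam + mu <= 1]. So it is a convex
    combination of two vertices and the centre. *)
Lemma convex_hull_regular_ngon :
  convex_hull (range (@regular_ngon R n)) = regular_region.
Proof.
apply/seteqP; split=> [x|x xK D [cD AD]].
  apply; split; first exact: regular_region_convex.
  by move=> _ [i _ <-] j; exact: edge_form_vertex_le.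
have AiD i : D (@regular_ngon R n i) by apply: AD; exists i.
have [m nm] : exists m, n = m.+1 by exists n.-1; rewrite prednK// (ltn_trans _ n2).
have D0 : D 0.
  (* The default 0 is never met: only indices below [n] enter the average. *)
  pose f k := if insub k is Some i then @regular_ngon R n i else 0.
  have fE (i : 'I_n) : f i = regular_ngon R i by rewrite /f valK.
  have := @convex_set_average R 'rV[R]_2 D f m cD.
  rewrite -nm (eq_bigr (fun i : 'I_n => regular_ngon R i)) => [|i _]; last exact: fE.
  rewrite sum_regular_ngon scaler0; apply => i im.
  have iN : (i < n)%N by rewrite nm.
  by rewrite -[i]/(val (Ordinal iN)) fE.
have comb (l : R) (y z : 'rV[R]_2) : 0 <= l <= 1 -> D y -> D z ->
    D (l *: y + (1 - l) *: z).
  move=> /andP[l0 l1] yD zD.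
  have := cD y z (Itv01 l0 l1); rewrite !inE; exact.
have [rho rho0 [j [t /andP[t0 t2] xE]]] := polar_sector x.
have s2 : 0 < sin (2 * a) by apply: sin_gt0_pi; have := a0; have := a3; lra.
(* The coefficients solve a linear system: [sin (2 a) unit_vec (b + t)] equals [sin (2 a - t)
   unit_vec b + sin t unit_vec (b + 2 a)]. *)
pose lam := rho * sin (2 * a - t) / (r * sin (2 * a)).
pose mu := rho * sin t / (r * sin (2 * a)).
have rs2 : 0 < r * sin (2 * a) by rewrite mulr_gt0.
have lam0 : 0 <= lam.
  rewrite divr_ge0 ?(ltW rs2)// mulr_ge0// sin_ge0_pi//.
  by have := a0; have := a3; lra.
have mu0 : 0 <= mu.
  rewrite divr_ge0 ?(ltW rs2)// mulr_ge0// sin_ge0_pi//.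
  by have := a0; have := a3; lra.
have xAB : x = lam *: regular_ngon R j + mu *: regular_ngon R (ordS j).
  rewrite regular_ngon_polar regular_ngon_succ_polar xE.
  rewrite (_ : j.*2.+2%:R * a = j.*2%:R * a + 2 * a); last by rewrite -natr1 -natr1; ring.
  rewrite /lam /mu; set b := _ * a; set c := 2 * a in s2 rs2 *.
  have rn0 : r != 0 by rewrite gt_eqF.
  have sn0 : sin c != 0 by rewrite gt_eqF.
  rewrite !scalerA; apply: rV2P; rewrite [RHS]mxE !scale_unit_vecE.
    by rewrite !cosD sinB; field; apply/andP.
  by rewrite !sinD cosN sinN; field; apply/andP.
have lm1 : lam + mu <= 1.
  have := xK j; rewrite xAB edge_form_linear edge_form_vertex.
  have -> : edge_form j (regular_ngon R (ordS j)) = r * cos a.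
    rewrite regular_ngon_succ_polar edge_formZ edge_form_unit_vec.
    by congr (_ * cos _); rewrite -[j.*2.+2%:R]natr1; ring.
  by rewrite -mulrDl -[leRHS]mul1r ler_pM2r// mulr_gt0.
have [lm0|lm0] := eqVneq (lam + mu) 0.
  have l00 : lam = 0 by lra.
  have m00 : mu = 0 by lra.
  by rewrite xAB l00 m00 !scale0r addr0.
have lmp : 0 < lam + mu by rewrite lt_neqAle eq_sym lm0 addr_ge0.
rewrite xAB.
have -> : lam *: regular_ngon R j + mu *: regular_ngon R (ordS j) =
  (lam + mu) *: ((lam / (lam + mu)) *: regular_ngon R j +
     (1 - lam / (lam + mu)) *: regular_ngon R (ordS j)) + (1 - (lam + mu)) *: 0.
  rewrite scaler0 addr0 scalerDr !scalerA; congr (_ *: _ + _ *: _); field => //.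
apply: (comb) => //; first by rewrite addr_ge0.
apply: (comb) => //; rewrite divr_ge0 ?(ltW lmp)//= ler_pdivrMr// mul1r; lra.
Qed.

Lemma regular_region_closed : closed (regular_region).
Proof.
have -> : regular_region =
    \bigcap_(j in [set: 'I_n]) (edge_form j @^-1` [set y | y <= r * cos a]).
  by apply/seteqP; split=> x xK j; [move=> _|]; apply: xK.
apply: closed_bigI => j _; apply: preimage_closed; last exact: closed_le.
by move=> x _; exact: edge_form_continuous.
Qed.

(** If some constraint is an equality, its value [r cos a] is positive, so any outward dilation of
    [x] violates it. Conversely, finitely many strict inequalities between continuous functions
    persist nearby. *)
Lemma regular_region_interior (x : 'rV[R]_2) :
  (regular_region)° x <-> forall j : 'I_n, edge_form j x < r * cos a.
Proof.
split=> xK.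
  move=> j; rewrite lt_neqAle (interior_subset xK) andbT.
  apply/eqP => xj.
  have : \forall e \near (0 : R), regular_region (x + e *: x).
    have c : {for 0, continuous (fun e : R => x + e *: x)}.
      by apply: continuousD; [exact: cst_continuous|apply: continuousZr_tmp].
    by apply: (c (regular_region)); rewrite scale0r addr0.
  case/nbhs_ballP => e /= e0 /(_ (e / 2)).
  rewrite /ball/= sub0r normrN gtr0_norm ?divr_gt0// ltr_pdivrMr// => H.
  have /H/(_ j) : e < e * 2 by lra.
  rewrite -[X in X + _]scale1r edge_form_linear xj mul1r.
  have := mulr_gt0 e0 h0; set h := r * cos a.
  by lra.
suff : \forall y \near x, forall j : 'I_n, edge_form j y <= r * cos a by [].
apply: (@filter_forall _ _ (fun (j : 'I_n) (y : 'rV[R]_2) => edge_form j y <= r * cos a)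
  (nbhs x) (nbhs_filter x)) => j.
have := @edge_form_continuous j x.
move=> /(_ [set y | y < r * cos a]) H.
have : nbhs (edge_form j x) [set y | y < r * cos a].
  by apply: open_nbhs_nbhs; split; [exact: open_lt|exact: xK].
by move=> /H; apply: (@filterS _ (nbhs x) (nbhs_filter x)) => y /= /ltW.
Qed.

Lemma boundary_regular_ngon :
  boundary (convex_hull (range (@regular_ngon R n))) =
  [set x | regular_region x /\ exists j : 'I_n, edge_form j x = r * cos a].
Proof.
rewrite convex_hull_regular_ngon /boundary.
rewrite -(closure_id _).1; last exact: regular_region_closed.
apply/seteqP; split=> x /= [xK].
  move=> /regular_region_interior/existsNP[j /negP]; rewrite -leNgt => jx.
  by split=> //; exists j; apply/eqP; rewrite eq_le xK.
move=> [j xj]; split=> // /regular_region_interior/(_ j).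
by rewrite xj ltxx.
Qed.

(** * Radial parametrization of the boundary by the Minkowski functional of the region, up to the
    factor [r cos a] *)

Definition gauge (x : 'rV[R]_2) : R := \big[Num.max/0]_(j < n) edge_form j x.

Lemma gauge_continuous : continuous gauge.
Proof.
apply: continuous_big; first exact: max_continuous.
by move=> j _; exact: edge_form_continuous.
Qed.

(** Every direction is within [a < pi / 2] of some edge normal. *)
Lemma gauge_unit_vec_gt0 (t : R) : 0 < gauge (unit_vec t).
Proof.
have [rho rho0 [j [u /andP[u0 u2] e]]] := polar_sector (unit_vec t).
have rp : 0 < rho.
  rewrite lt_neqAle rho0 andbT; apply/eqP => r00.
  have := cos2Dsin2 t; rewrite -!unit_vecE e -r00 scale0r !mxE expr0n/= addr0.
  by move=> /eqP; rewrite eq_sym oner_eq0.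
apply: lt_le_trans (le_bigmax _ _ j).
rewrite e edge_formZ edge_form_unit_vec mulr_gt0//.
rewrite -natr1 (_ : _ - _ = u - a); last by rewrite -/a; ring.
by apply: cos_gt0_pihalf; have := a0; have := a3; lra.
Qed.

Definition boundary_curve (s : R) : 'rV[R]_2 :=
  (r * cos a / gauge (unit_vec (2 * pi * s))) *: unit_vec (2 * pi * s).

Lemma unit_vec_continuous : continuous (fun s : R => unit_vec (2 * pi * s)).
Proof.
have c : continuous (fun s : R => 2 * pi * s) by move=> s; exact: mulrl_continuous.
move=> s; apply: (@continuousD R 'rV[R]_2 R (fun s => cos (2 * pi * s) *: delta_mx 0 0)
  (fun s => sin (2 * pi * s) *: delta_mx 0 1)); apply: continuousZr_tmp.
  by apply: continuous_comp; [exact: c|exact: continuous_cos].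
by apply: continuous_comp; [exact: c|exact: continuous_sin].
Qed.

Lemma boundary_curve_continuous : continuous boundary_curve.
Proof.
move=> s; apply: (@continuousZ R 'rV[R]_2 R
  (fun s => r * cos a / gauge (unit_vec (2 * pi * s)))
  (fun s => unit_vec (2 * pi * s))); last exact: unit_vec_continuous.
apply: (@continuousM R R (fun=> r * cos a)
  (fun s => (gauge (unit_vec (2 * pi * s)))^-1)); first exact: cst_continuous.
apply: continuousV; first by rewrite gt_eqF// gauge_unit_vec_gt0.
by apply: continuous_comp; [exact: unit_vec_continuous|exact: gauge_continuous].
Qed.

Lemma boundary_curve_periodic : periodic boundary_curve 1.
Proof.
move=> s; rewrite /boundary_curve (_ : 2 * pi * (s + 1) = 2 * pi * s + 2 * pi).
  by rewrite unit_vecD2pi.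
by ring.
Qed.

Lemma gaugeP (x : 'rV[R]_2) (c : R) : 0 <= c ->
  (forall j, edge_form j x <= c) -> (exists j, edge_form j x = c) -> gauge x = c.
Proof.
move=> c0 xc [j xj]; apply/eqP; rewrite eq_le; apply/andP; split.
  by apply/bigmax_leP; split=> // i _; exact: xc.
by rewrite -xj; exact: (le_bigmax _ (fun i => edge_form i x)).
Qed.

Lemma gauge_attained (x : 'rV[R]_2) :
  0 < gauge x -> exists j : 'I_n, edge_form j x = gauge x.
Proof.
move=> g0; apply/not_existsP => H.
have : gauge x < gauge x; last by rewrite ltxx.
rewrite {1}/gauge; apply/bigmax_ltP; split=> // i _.
rewrite lt_neqAle (introN eqP (H i))/=.
exact: (le_bigmax _ (fun i => edge_form i x)).
Qed.

Lemma boundary_curve_range :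
  range boundary_curve = boundary (convex_hull (range (@regular_ngon R n))).
Proof.
rewrite boundary_regular_ngon; apply/seteqP; split=> [_ [s _ <-]|x [xK [j xj]]].
  have g0 := gauge_unit_vec_gt0 (2 * pi * s).
  split=> [j|].
    rewrite edge_formZ -mulrA ler_piMr ?(ltW h0)// mulrC ler_pdivrMr// mul1r.
    exact: (le_bigmax _ (fun i => edge_form i _)).
  have [j ej] := gauge_attained g0; exists j.
  by rewrite edge_formZ ej divfK// gt_eqF.
have [rho rho0 [t _ xE]] := polar_form x.
have rp : 0 < rho.
  rewrite lt_neqAle rho0 andbT; apply/eqP => r00.
  move: xj; rewrite xE -r00 edge_formZ mul0r => /eqP.
  by rewrite lt_eqF.
exists (t / (2 * pi)) => //.
have tE : 2 * pi * (t / (2 * pi)) = t.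
  by rewrite mulrC divfK// mulf_neq0// gt_eqF// pi_gt0.
have gE : gauge (unit_vec t) = r * cos a / rho.
  apply: gaugeP; first by rewrite divr_ge0// ltW.
    by move=> i; rewrite ler_pdivlMr// mulrC -edge_formZ -xE; exact: xK.
  by exists j; rewrite -xj xE edge_formZ mulrC mulKf// gt_eqF.
rewrite /boundary_curve tE gE xE; congr (_ *: _).
by rewrite invf_div mulrCA divff ?mulr1// gt_eqF.
Qed.

(** Equal directions give [cos (2 pi (s - t)) = 1], hence [sin (pi (s - t)) = 0], impossible for
    [0 < s - t < 1]. *)
Lemma unit_vec_inj (s t : R) : 0 <= s < 1 -> 0 <= t < 1 ->
  unit_vec (2 * pi * s) = unit_vec (2 * pi * t) -> s = t.
Proof.
have pi0 := pi_gt0 R.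
wlog st : s t / t <= s => [wl|] s01 t01 e.
  have [/wl|/ltW ts] := leP t s; first exact.
  by apply/esym; apply: wl.
have c0 := congr1 (fun x : 'rV[R]_2 => x 0 0) e.
have s0 := congr1 (fun x : 'rV[R]_2 => x 0 1) e.
rewrite /= !unit_vecE in c0 s0.
have : cos ((pi * (s - t)) *+ 2) = 1.
  rewrite (_ : _ *+ 2 = 2 * pi * s - 2 * pi * t); last by ring.
  by rewrite cosB c0 s0 -!expr2 cos2Dsin2.
rewrite cos_mulr2n cos2sin2 => /eqP h.
have {h} /eqP : sin (pi * (s - t)) ^+ 2 = 0 by move/eqP: h; lra.
rewrite sqrf_eq0 => h.
apply/eqP; apply: contraTT h => st'.
rewrite gt_eqF// sin_gt0_pi//.
have ds : 0 < s - t by rewrite subr_gt0 lt_neqAle eq_sym st'.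
by rewrite mulr_gt0//= gtr_pMr//; lra.
Qed.

Lemma boundary_curve_inj : set_inj `[0, 1[ boundary_curve.
Proof.
move=> s t; rewrite !inE/= !in_itv/= => s01 t01.
have gs := gauge_unit_vec_gt0 (2 * pi * s).
have gt := gauge_unit_vec_gt0 (2 * pi * t).
rewrite /boundary_curve; set c := _ / gauge _; set d := _ / gauge _ => e.
have c0 : 0 < c by rewrite divr_gt0.
have d0 : 0 < d by rewrite divr_gt0.
have e0 := congr1 (fun x : 'rV[R]_2 => x 0 0) e.
have e1 := congr1 (fun x : 'rV[R]_2 => x 0 1) e.
rewrite /= !scale_unit_vecE in e0 e1.
(* Comparing squared norms shows that the radii agree; only the directions remain. *)
have cd2 : c ^+ 2 = d ^+ 2.
  rewrite -[LHS]mulr1 -(cos2Dsin2 (2 * pi * s)) mulrDr -!exprMn e0 e1 !exprMn.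
  by rewrite -mulrDr cos2Dsin2 mulr1.
have cd : c = d by apply/eqP; rewrite -(eqrXn2 (n:=2))// ?ltW// cd2.
apply: unit_vec_inj => //.
by move: e; rewrite -cd; apply: scalerI; rewrite gt_eqF.
Qed.

Lemma boundary_curve_vertex (i : 'I_n) :
  boundary_curve (i%:R / n%:R) = regular_ngon R i.
Proof.
have e : 2 * pi * (i%:R / n%:R) = i.*2%:R * a.
  by rewrite -muln2 natrM /a; field.
have gE : gauge (unit_vec (i.*2%:R * a)) = cos a.
  apply: gaugeP; first exact: ltW.
    move=> j; rewrite -(ler_pM2l r0) -edge_formZ -regular_ngon_polar//.
    exact: edge_form_vertex_le.
  exists i; apply: (mulfI (lt0r_neq0 r0)).
  by rewrite -edge_formZ -regular_ngon_polar// edge_form_vertex.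
by rewrite /boundary_curve e gE mulfK ?gt_eqF// regular_ngon_polar.
Qed.

(** The cross product of the two vectors from vertex 0 to vertices 1 and 2 is
    [2 r^2 sin (2 a) (1 - cos (2 a))], which is positive. *)
Lemma regular_ngon_not_collinear : ~ collinear (@regular_ngon R n).
Proof.
move=> [P [v H]].
have n1 : (1 < n)%N by exact: ltnW.
have n0 : (0 < n)%N by exact: ltnW.
have [s0 e0] := H (Ordinal n0); have [s1 e1] := H (Ordinal n1).
have [s2 e2] := H (Ordinal n2).
pose x i := @regular_ngon R n i 0 0; pose y i := @regular_ngon R n i 0 1.
have cross : (x (Ordinal n1) - x (Ordinal n0)) * (y (Ordinal n2) - y (Ordinal n0)) -
    (y (Ordinal n1) - y (Ordinal n0)) * (x (Ordinal n2) - x (Ordinal n0)) = 0.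
  by rewrite /x /y e0 e1 e2 !mxE; ring.
move: cross; rewrite /x /y !regular_ngonE/= mul0r cos0 sin0.
rewrite (_ : 1 * (2 * pi / n%:R) = a *+ 2); last by rewrite /a; ring.
rewrite (_ : 2 * (2 * pi / n%:R) = (a *+ 2) *+ 2); last by rewrite /a; ring.
rewrite -/r (cos_mulr2n (a *+ 2)) (sin_mulr2n (a *+ 2)); set c := cos (a *+ 2).
set s := sin (a *+ 2).
have sp : 0 < s by apply: sin_gt0_pi; have := a0; have := a3; lra.
have c1 : c < 1 by rewrite /c cos_mulr2n cos2sin2; have := exprn_gt0 2 sina; lra.
rewrite (_ : _ - _ = 2 * r ^+ 2 * s * (1 - c)).
  by move=> /eqP; rewrite gt_eqF// !mulr_gt0 ?exprn_gt0// subr_gt0.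
by ring.
Qed.

Lemma regular_ngon_convex_polygon : convex_polygon (@regular_ngon R n).
Proof.
exists boundary_curve; split.
  left; split; first exact: regular_ngon_not_collinear.
  split; [exact: boundary_curve_continuous|exact: boundary_curve_periodic
         |exact: boundary_curve_inj|exact: boundary_curve_range].
exists (fun i : 'I_n => i%:R / n%:R); split=> [i j ij|i j|i].
- by rewrite ltr_pM2r ?invr_gt0// ltr_nat.
- rewrite -[X in _ + X](divff nR) -mulrDl ltr_pM2r ?invr_gt0// -natrD ltr_nat.
  by rewrite ltn_addl.
- by rewrite boundary_curve_vertex.
Qed.

End regular_ngon_convex.

Unset Implicit Arguments.

Theorem theorem5p1 (R : realType) (alpha : R) (n : nat)
    (halpha : alpha <= 2) (hn : (5 <= n)%N) :
  convex_unit_polygon (@regular_ngon R n) /\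
  forall A : 'I_n -> 'rV[R]_2, convex_unit_polygon A ->
    ((forall B : 'I_n -> 'rV[R]_2, convex_unit_polygon B ->
        (energy alpha B <= energy alpha A)%E) <->
     congruent A (@regular_ngon R n)).
Proof.
have n1 : (1 < n)%N by exact: leq_trans hn.
have regP : convex_unit_polygon (@regular_ngon R n).
  split; last exact: regular_ngon_unit_edges.
  by apply: regular_ngon_convex_polygon; exact: leq_trans hn.
(* A maximizer is compared with the regular polygon, itself a competitor; conversely, congruence
   preserves energy. *)
split=> // A [_ uA]; split=> [Amax|/energy_congruent -> B [_ uB]].
  exact: energy_max_congruent halpha hn uA (Amax _ regP).
exact: energy_le_regular_ngon.
Qed.
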